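(* Let $X,Y$ be Polish spaces and let $\mu\in\mathcal P(X)$, $\nu\in\mathcal P(Y)$ be continuous (i.e. non-atomic). Then $\mathrm{Cpl}_{biM}(\mu,\nu)$ is weakly dense in $\mathrm{Cpl}(\mu,\nu)$. Moreover, if $p\in[1,\infty)$ and $\mu,\nu$ have finite $p$-th moments with respect to compatible metrics $d_X,d_Y$, then $\mathrm{Cpl}_{biM}(\mu,\nu)$ is dense in $\mathrm{Cpl}(\mu,\nu)$ with respect to $\mathcal W_p$ for the product metric $d^p=d_X^p+d_Y^p$ on $X\times Y$.
   Context: $\mathrm{Cpl}(\mu,\nu)$ is the set of couplings of $\mu,\nu$; $\mathrm{Cpl}_{biM}(\mu,\nu)=\{(\mathrm{id},T)_\ast\mu: T:X\to Y \text{ Borel bijection}, T_\ast\mu=\nu\}$. $\mathcal W_p^p(\alpha,\beta)=\inf_{\gamma\in\mathrm{Cpl}(\alpha,\beta)}\int d^p\,d\gamma$. Standing assumption: Polish spaces are uncountable. *)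

(* Defs.v *)
From HB Require Import structures.
From mathcomp Require Import all_boot all_order all_algebra.
From mathcomp Require Import all_classical all_reals all_analysis.
Set Implicit Arguments. Unset Strict Implicit. Unset Printing Implicit Defensive.
Import Order.TTheory GRing.Theory Num.Theory.
Import numFieldNormedType.Exports.
Local Open Scope classical_set_scope.
Local Open Scope ring_scope.

Definition is_metric {R : realType} {X : Type} (d : X -> X -> R) : Prop :=
  (forall x y, 0 <= d x y) /\ (forall x y, d x y = 0 <-> x = y) /\
  (forall x y, d x y = d y x) /\ (forall x y z, d x z <= d x y + d y z).

Definition compatible_metric {R : realType} {X : topologicalType}
    (d : X -> X -> R) : Prop :=
  is_metric d /\
  forall A : set X, open A <->
    (forall x, A x -> exists2 e : R, 0 < e & forall y, d x y < e -> A y).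

Definition metric_complete {R : realType} {X : Type} (d : X -> X -> R) : Prop :=
  forall u : nat -> X,
    (forall e : R, 0 < e -> exists N : nat, forall m n : nat,
        (N <= m)%N -> (N <= n)%N -> d (u m) (u n) < e) ->
    exists l : X, forall e : R, 0 < e -> exists N : nat, forall n : nat,
        (N <= n)%N -> d (u n) l < e.

Definition separable_space (X : topologicalType) : Prop :=
  exists s : nat -> X, forall A : set X, open A -> A !=set0 -> exists n, A (s n).

Definition polish (R : realType) (X : topologicalType) : Prop :=
  separable_space X /\
  exists d : X -> X -> R, compatible_metric d /\ metric_complete d.

Definition borel (X : ptopologicalType) := g_sigma_algebraType (@open X).

Section Couplings.
Context {R : realType} {X Y : ptopologicalType}.
Local Open Scope ereal_scope.

Definition nonatomic (mu : set (borel X) -> \bar R) : Prop :=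
  forall x : X, mu [set x] = 0.

Definition cpl (mu : set (borel X) -> \bar R) (nu : set (borel Y) -> \bar R)
    (gamma : set (borel X * borel Y)%type -> \bar R) : Prop :=
  (forall A : set (borel X), measurable A -> gamma (fst @^-1` A) = mu A) /\
  (forall B : set (borel Y), measurable B -> gamma (snd @^-1` B) = nu B).

Definition cpl_biM (mu : set (borel X) -> \bar R) (nu : set (borel Y) -> \bar R)
    (gamma : set (borel X * borel Y)%type -> \bar R) : Prop :=
  exists T : borel X -> borel Y,
    [/\ measurable_fun setT T, bijective T,
        (forall B : set (borel Y), measurable B -> pushforward mu T B = nu B) &
        (forall C : set (borel X * borel Y)%type, measurable C ->
            gamma C = pushforward mu (fun x => (x, T x)) C)].

Definition finite_moment (p : R) (d : X -> X -> R) (mu : probability (borel X) R) :=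
  exists x0 : X, \int[mu]_x ((d x0 x) `^ p)%:E < +oo.

End Couplings.


(* p-Wasserstein distance to the power p on borel X * borel Y for the
   product metric d^p = dX^p + dY^p *)
Definition Wpp {R : realType} {X Y : ptopologicalType} (p : R)
    (dX : X -> X -> R) (dY : Y -> Y -> R)
    (alpha beta : set (borel X * borel Y)%type -> \bar R) : \bar R :=
  ereal_inf [set (\int[pi]_z ((dX z.1.1 z.2.1 `^ p + dY z.1.2 z.2.2 `^ p)%:E))%E
            | pi in [set pi : probability
                        ((borel X * borel Y) * (borel X * borel Y))%type R
                     | (forall A, measurable A -> pi (fst @^-1` A) = alpha A) /\
                       (forall B, measurable B -> pi (snd @^-1` B) = beta B)]].

Definition Wp {R : realType} {X Y : ptopologicalType} (p : R)
    (dX : X -> X -> R) (dY : Y -> Y -> R)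
    (alpha beta : set (borel X * borel Y)%type -> \bar R) : \bar R :=
  poweR (Wpp p dX dY alpha beta) p^-1.

(* Main.v *)
Require Import Defs.
From HB Require Import structures.
From mathcomp Require Import all_boot all_order all_algebra.
From mathcomp Require Import all_classical all_reals all_analysis.
From mathcomp Require Import measurable_realfun lra.
Import Order.TTheory GRing.Theory Num.Theory.
Import numFieldNormedType.Exports.
Local Open Scope classical_set_scope.
Local Open Scope ring_scope.
Set Implicit Arguments.
Unset Strict Implicit.
Unset Printing Implicit Defensive.

(* Cut X and Y into countably many Borel cells of small diameter.  The measure
   spaces (X, mu), (Y, nu) and (X * Y, gamma) are standard Borel and atomless,
   so there are Borel isomorphisms S : X -> X * Y and U : Y -> X * Y carrying mu
   and nu to gamma such that, almost everywhere, S keeps the cell of x as the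
   cell of the first coordinate and U keeps the cell of y as the cell of the
   second one.  Then T := U^-1 o S is a Borel bijection carrying mu to nu, and
   the law of ((x, T x), S x) under mu couples (id, T)_* mu with gamma while
   moving almost no point by more than the mesh.

   The isomorphism theorem goes through the unit interval I.  A Polish space is
   coded by the balls of a countable basis containing a point, hence is Borel
   isomorphic to a Lebesgue-null Borel subset E of I.  The quantile function of
   an atomless law is an injection of I that carries Lebesgue measure to that
   law; restricted to a compact set of positive measure it embeds I into E, so
   Cantor-Schroeder-Bernstein gives a Borel bijection I -> E.  Transporting the
   measure back to I and applying Cantor-Schroeder-Bernstein once more, to the
   quantile function and to this embedding with null image, only alters the
   quantile function on a null set. *)

(** * Borel isomorphisms between measurable sets: composition, gluing, Cantor-Schroeder-Bernstein *)

(** [f] and [g] are total and constrained only on [A] and [B], so isomorphisms of subsets restrict,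
    compose and glue without subtypes. *)
Definition misom {d1 d2} {X : measurableType d1} {Y : measurableType d2}
    (A : set X) (B : set Y) (f : X -> Y) (g : Y -> X) : Prop :=
  [/\ measurable A /\ measurable B, measurable_fun A f, measurable_fun B g,
      forall x, A x -> B (f x) /\ g (f x) = x &
      forall y, B y -> A (g y) /\ f (g y) = y].

Lemma misom_sym d1 d2 (X : measurableType d1) (Y : measurableType d2)
    (A : set X) (B : set Y) f g : misom A B f g -> misom B A g f.
Proof. by case=> -[mA mB] mf mg fg gf; split. Qed.

Lemma misom_trans d1 d2 d3 (X : measurableType d1) (Y : measurableType d2)
    (Z : measurableType d3) (A : set X) (B : set Y) (C : set Z) f g f' g' :
  misom A B f g -> misom B C f' g' -> misom A C (f' \o f) (g \o g').
Proof.
move=> [[mA mB] mf mg fg gf] [[_ mC] mf' mg' fg' gf']; split=> //.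
- by apply: (measurable_comp mB) => // _ [x /fg[Bx _] <-].
- by apply: (measurable_comp mB) => // _ [x /gf'[Bx _] <-].
- by move=> x /fg[/fg'[Cx e] e'] /=; rewrite e e'.
- by move=> z /gf'[/gf[Ax e] e'] /=; rewrite e e'.
Qed.

Lemma misom_refl d (X : measurableType d) (A : set X) :
  measurable A -> misom A A id id.
Proof. by move=> mA; split. Qed.

Lemma misom_sub d1 d2 (X : measurableType d1) (Y : measurableType d2)
    (A A' : set X) (B : set Y) f g : misom A B f g -> measurable A' ->
  A' `<=` A -> misom A' (B `&` g @^-1` A') f g.
Proof.
move=> [[mA mB] mf mg fg gf] mA' A'A.
have mB' : measurable (B `&` g @^-1` A') by exact: mg.
split=> //.
- exact: measurable_funS mf.
- by apply: measurable_funS mg => //; exact: subIsetl.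
- by move=> x A'x; have [Bx e] := fg _ (A'A _ A'x); split => //; split=> //=; rewrite e.
- by move=> y [By A'y]; have [_ e] := gf _ By.
Qed.

(** There are only countably many cells. The point [f (a x) x] carries the label [a x], so the glued
    inverse selects the matching [g (a x)]. *)
Lemma misom_glue d1 d2 (X : measurableType d1) (Y : measurableType d2)
    (a : X -> nat) (b : Y -> nat) (f : nat -> X -> Y) (g : nat -> Y -> X) :
  (forall i, misom (a @^-1` [set i]) (b @^-1` [set i]) (f i) (g i)) ->
  misom setT setT (fun x => f (a x) x) (fun y => g (b y) y).
Proof.
move=> fg; split => //.
- rewrite (_ : setT = \bigcup_i (a @^-1` [set i])); last first.
    by apply/seteqP; split=> // x _; exists (a x).
  apply/measurable_fun_bigcup => i; first by have [[]] := fg i.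
  have [_ mf _ _ _] := fg i; apply: eq_measurable_fun mf => x.
  by rewrite inE /= => ->.
- rewrite (_ : setT = \bigcup_i (b @^-1` [set i])); last first.
    by apply/seteqP; split=> // x _; exists (b x).
  apply/measurable_fun_bigcup => i; first by have [[]] := fg i.
  have [_ _ mg _ _] := fg i; apply: eq_measurable_fun mg => x.
  by rewrite inE /= => ->.
- by move=> x _; have [_ _ _ h _] := fg (a x); have [//|/= -> ->] := h x.
- by move=> x _; have [_ _ _ _ h] := fg (b x); have [//|/= -> ->] := h x.
Qed.

(* h is g^-1 on the g f-orbits of the points of A
   that come from B outside the image of f, and f elsewhere. *)
Lemma misom_bernstein d1 d2 (X : measurableType d1) (Y : measurableType d2)
    (A A1 : set X) (B B1 : set Y) f f' g g' :
  misom A B1 f f' -> B1 `<=` B -> misom B A1 g g' -> A1 `<=` A ->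
  exists h h', misom A B h h' /\ forall x, A x -> ~ A1 x -> h x = f x.
Proof.
move=> [[mA mB1] mf mf' ff' f'f] B1B [[mB mA1] mg mg' gg' g'g] A1A.
(* [D n] is the image of the complement of [B1] in [B] under [g], then under [n] rounds of [g \o f];
   written with the inverses, it is visibly measurable. *)
pose fix D n := if n is n'.+1
  then A1 `&` g' @^-1` (B1 `&` f' @^-1` (D n')) else A1 `&` g' @^-1` (B `\` B1).
have mD n : measurable (D n).
  elim: n => [|n IH] /=; first by apply: mg' => //; exact: measurableD.
  by apply: mg' => //; exact: mf'.
pose U := \bigcup_n D n.
have mU : measurable U by exact: bigcup_measurable.
have UA1 : U `<=` A1 by move=> x [[|n] _ []].
have gU y : B y -> ~ U (g y) -> B1 y.
  move=> By nU; apply: contrapT => nB1; apply: nU; exists 0%N => //=.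
  by have [? e] := gg' _ By; split=> //; rewrite /= e.
have gU' y : B y -> ~ U (g y) -> ~ U (f' y).
  move=> By nU [n _ Dn]; apply: (nU); exists n.+1 => //=.
  by have [? e] := gg' _ By; do !split=> //=; rewrite e //; exact: gU.
have fU x : A x -> ~ U x -> ~ U (g (f x)).
  move=> Ax nU; have [B1x e] := ff' _ Ax; have [A1x e'] := gg' _ (B1B _ B1x).
  move=> [[|n] _ /=] [_]; rewrite e'; first by case.
  by case=> _; rewrite /= e => Dn; apply: nU; exists n.
pose h x := if x \in U then g' x else f x.
pose h' y := if g y \in U then g y else f' y.
exists h, h'; split; last first.
  (* [U] lies in [A1], so [h] can differ from [f] only there; this matters when [A1] is a null
     set. *)
  by move=> x Ax nA1; rewrite /h memNset// => /UA1.
have mpre : measurable (B `&` g @^-1` U) by exact: mg.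
split=> //.
- apply: measurable_fun_if => //.
  + apply: (measurable_fun_bool true).
    rewrite (_ : _ `&` _ = A `&` U); first exact: measurableI.
    by apply/seteqP; split=> x /= [Ax Ux]; split=> //;
      [exact: set_mem Ux|exact: mem_set].
  + apply: (measurable_funS mA1 _ mg') => x /= [_ /set_mem]; exact: UA1.
  + by apply: (measurable_funS mA _ mf) => x /= [].
- apply: measurable_fun_if => //.
  + apply: (measurable_fun_bool true).
    rewrite (_ : _ `&` _ = B `&` g @^-1` U) //.
    by apply/seteqP; split=> x /= [Ax Ux]; split=> //;
      [exact: set_mem Ux|exact: mem_set].
  + by apply: (measurable_funS mB _ mg) => x /= [].
  + apply: (measurable_funS mB1 _ mf') => x /= [Bx /negbT /negP nU].
    by apply: gU => // Ux; apply: nU; rewrite inE.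
- move=> x Ax; rewrite /h /h'; case: ifPn => [/set_mem Ux|/negP nU].
    by have [Bx e] := g'g _ (UA1 _ Ux); rewrite e mem_set.
  have {}nU : ~ U x by move=> Ux; apply: nU; rewrite inE.
  have [B1x e] := ff' _ Ax; rewrite memNset; last exact: fU.
  by split => //; exact: B1B.
- move=> y By; rewrite /h /h'; case: ifPn => [/[dup] yU /set_mem Ux|/negP nU].
    by have [A1x e] := gg' _ By; rewrite yU e; split=> //; exact: A1A.
  have {}nU : ~ U (g y) by move=> Ux; apply: nU; rewrite inE.
  have B1y := gU _ By nU; have [Ay e] := f'f _ B1y; rewrite memNset//.
  exact: gU'.
Qed.

(** * Push-forwards, conditioning, and uniqueness of laws on the line *)

Lemma pushforward_probability d1 d2 (X : measurableType d1)
    (Y : measurableType d2) (R : realType) (P : probability X R) (f : X -> Y) :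
  measurable_fun setT f ->
  exists P' : probability Y R, forall A, P' A = P (f @^-1` A).
Proof.
by move=> mf; exists (distribution P (mfun_Sub (mem_set mf))). Qed.

Lemma conditional_probability d (T : measurableType d) (R : realType)
    (m : {measure set T -> \bar R}) (A : set T) : measurable A ->
  (0 < m A)%E -> (m A < +oo)%E ->
  exists P : probability T R,
    forall B, P B = (m (B `&` A) * ((fine (m A))^-1)%:E)%E.
Proof.
move=> mA A0 Aoo.
(* [mnormalize] falls back on [dirac point] when the total mass is zero or infinite, which is
   excluded here. *)
exists (mnormalize (mrestr m mA) (dirac point)) => B /=.
have AE : mrestr m mA setT = m A by rewrite /mrestr setTI.
by rewrite /mnormalize /= !AE gt_eqF//= lt_eqF.
Qed.

(** Closed left rays are stable under intersection, generate the Borel sets (as complements of open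
    right rays) and exhaust the line. *)
Lemma probability_ray_unique (R : realType)
    (m1 m2 : {measure set (measurableTypeR R) -> \bar R}) :
  (forall t : R, m1 `]-oo, t]%classic = m2 `]-oo, t]%classic) ->
  (forall t : R, (m1 `]-oo, t]%classic < +oo)%E) ->
  forall A, measurable A -> m1 A = m2 A.
Proof.
move=> m12 m1oo A mA.
pose G := [set A : set (measurableTypeR R) | exists t : R, A = `]-oo, t]%classic].
apply: (measure_unique G (fun k => `]-oo, k%:R]%classic)) => //.
- have -> : @measurable _ (measurableTypeR R) = (@ocitv R).-sigma.-measurable by [].
  rewrite RGenOInfty.measurableE; apply/seteqP; split.
  + apply: smallest_sub; first exact: smallest_sigma_algebra.
    move=> _ [t ->]; rewrite -setCitvl.
    by apply: sigma_algebraC; apply: sub_sigma_algebra; exists t.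
  + apply: smallest_sub; first exact: smallest_sigma_algebra.
    move=> _ [t ->]; rewrite -setCitvr.
    by apply: sigma_algebraC; apply: sub_sigma_algebra; exists t.
- move=> _ _ [s ->] [t ->]; exists (Num.min s t).
  by apply/seteqP; split=> x /=; rewrite !in_itv/= le_min => /andP.
- by move=> k; exists k%:R.
- apply/seteqP; split=> // x _; exists (Num.truncn `|x|).+1 => //=.
  by rewrite in_itv/= (le_trans (ler_norm x))// ltW// truncnS_gt.
- by move=> _ [t ->].
Qed.

(** * Distribution and quantile functions of atomless laws on the line *)

Definition real_cdf (R : realType) (m : set (measurableTypeR R) -> \bar R)
  (t : R) : R := fine (m `]-oo, t]%classic).

(** The generalized inverse of the distribution function. For a probability [m] and [0 < s < 1] the
    set is nonempty and bounded below, so [inf] is a genuine infimum and not a default value. *)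
Definition quantile (R : realType) (m : set (measurableTypeR R) -> \bar R)
  (s : R) : R := inf [set t | s <= real_cdf m t].

Section quantile.
Variables (R : realType) (m : probability (measurableTypeR R) R).
Hypothesis m0 : forall t : R, m [set t] = 0%E.
Let F := real_cdf m.
Let Q := quantile m.
Local Notation I := (`]0, 1[%classic : set (measurableTypeR R)).

Lemma real_cdfE t : m `]-oo, t]%classic = (F t)%:E.
Proof. by rewrite /F /real_cdf fineK// fin_num_measure. Qed.

Lemma real_cdf_nd : {homo F : s t / s <= t}.
Proof.
move=> s t st; rewrite -lee_fin -!real_cdfE.
by apply: le_measure; rewrite ?inE//; apply: subset_itvl; rewrite bnd_simp.
Qed.

Lemma real_cdf_ge0 t : 0 <= F t. Proof. by rewrite -lee_fin -real_cdfE. Qed.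

Lemma real_cdf_le1 t : F t <= 1.
Proof. by rewrite -lee_fin -real_cdfE probability_le1. Qed.

Lemma real_cdf_right s x : (forall n, s <= F (x + n.+1%:R^-1)) -> s <= F x.
Proof.
move=> sF; rewrite -lee_fin -real_cdfE.
pose G n : set (measurableTypeR R) := `]-oo, x + n.+1%:R^-1]%classic.
have mG n : measurable (G n) by exact: measurable_itv.
have GE : `]-oo, x]%classic = \bigcap_n G n by exact: (itvNycEbigcap false).
have Gcvg : (m \o G) n @[n --> \oo] --> m (\bigcap_n G n).
  apply: nonincreasing_cvg_mu => //.
  - by apply: (@le_lt_trans _ _ 1%E); [exact: probability_le1|exact: ltry].
  - by rewrite -GE.
  - move=> i j ij; apply/subsetPset; apply: subset_itvl.
    by rewrite bnd_simp lerD2l lef_pV2 ?posrE// ler_nat.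
rewrite GE -(cvg_lim _ Gcvg)//; apply: lime_ge.
  by apply/cvg_ex; eexists; exact: Gcvg.
by apply: nearW => n; rewrite /= /G real_cdfE lee_fin.
Qed.

(** Continuity from below concerns the open ray ending at [x]; the absence of an atom at [x] extends
    the bound to the closed ray. *)
Lemma real_cdf_left s x : (forall n, F (x - n.+1%:R^-1) <= s) -> F x <= s.
Proof.
move=> sF; rewrite -lee_fin -real_cdfE.
pose G n : set (measurableTypeR R) := `]-oo, x - n.+1%:R^-1]%classic.
have mG n : measurable (G n) by exact: measurable_itv.
have GE : `]-oo, x[%classic = \bigcup_n G n.
  apply/seteqP; split=> y /=; rewrite in_itv/=.
    move=> yx; have [n nP] := ltr_add_invr yx.
    by exists n => //; rewrite /G /= in_itv/= lerBrDr ltW.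
  by case=> n _; rewrite /G /= in_itv/= => /le_lt_trans; apply; rewrite ltrBlDr ltrDl.
have -> : m `]-oo, x]%classic = m `]-oo, x[%classic.
  rewrite -(setUitv1 true (a:=-oo%O)) ?bnd_simp//= measureU//; last first.
    by apply/seteqP; split=> y //= [/[swap] ->]; rewrite in_itv/= ltxx.
  by apply: (eq_trans _ (adde0 _)); congr (_ + _)%E; exact: m0.
have Gcvg : (m \o G) n @[n --> \oo] --> m (\bigcup_n G n).
  apply: nondecreasing_cvg_mu => //.
  - by rewrite -GE.
  - move=> i j ij; apply/subsetPset; apply: subset_itvl.
    by rewrite bnd_simp lerD2l lerN2 lef_pV2 ?posrE// ler_nat.
rewrite GE -(cvg_lim _ Gcvg)//; apply: lime_le.
  by apply/cvg_ex; eexists; exact: Gcvg.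
by apply: nearW => n; rewrite /= /G real_cdfE lee_fin.
Qed.

Lemma real_cdf_y s : s < 1 -> exists t, s <= F t.
Proof.
move=> s1; apply: contrapT => /forallNP sF.
pose G n : set (measurableTypeR R) := `]-oo, n%:R]%classic.
have mG n : measurable (G n) by exact: measurable_itv.
have GE : setT = \bigcup_n G n.
  apply/seteqP; split=> // x _; exists (Num.truncn `|x|).+1 => //=.
  by rewrite /G /= in_itv/= (le_trans (ler_norm x))// ltW// truncnS_gt.
have Gcvg : (m \o G) n @[n --> \oo] --> m (\bigcup_n G n).
  apply: nondecreasing_cvg_mu => //.
  - by rewrite -GE.
  - by move=> i j ij; apply/subsetPset; apply: subset_itvl; rewrite bnd_simp ler_nat.
move: s1; rewrite -lte_fin -(probability_setT m) GE -(cvg_lim _ Gcvg)//.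
apply/negP; rewrite -leNgt; apply: lime_le; first by apply/cvg_ex; eexists; exact: Gcvg.
apply: nearW => n; rewrite /= /G real_cdfE lee_fin ltW// ltNge.
exact/negP/sF.
Qed.

Lemma real_cdf_Ny s : 0 < s -> exists t, F t < s.
Proof.
move=> s0; apply: contrapT => /forallNP sF.
pose G n : set (measurableTypeR R) := `]-oo, - n%:R]%classic.
have mG n : measurable (G n) by exact: measurable_itv.
have GE : set0 = \bigcap_n G n.
  apply/seteqP; split=> // x /(_ (Num.truncn `|x|).+1 Logic.I) /=.
  rewrite /G /= in_itv/= lerNr => /(lt_le_trans (truncnS_gt _)).
  by rewrite ltNge -normrN ler_norm.
have Gcvg : (m \o G) n @[n --> \oo] --> m (\bigcap_n G n).
  apply: nonincreasing_cvg_mu => //.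
  - by apply: (@le_lt_trans _ _ 1%E); [exact: probability_le1|exact: ltry].
  - by rewrite -GE.
  - by move=> i j ij; apply/subsetPset; apply: subset_itvl; rewrite bnd_simp lerN2 ler_nat.
have : (s%:E <= m (\bigcap_n G n))%E.
  rewrite -(cvg_lim _ Gcvg)//; apply: lime_ge.
    by apply/cvg_ex; eexists; exact: Gcvg.
  apply: nearW => n; rewrite /= /G real_cdfE lee_fin leNgt.
  exact/negP/sF.
by rewrite -GE measure0 lee_fin leNgt s0.
Qed.

(** Equality, and not only [>=], comes from the two-sided continuity of [F]. It makes [F] a left
    inverse of [Q] on [I]. *)
Lemma real_cdf_quantile s : I s -> F (Q s) = s.
Proof.
rewrite /= in_itv/= => /andP[s0 s1].
have Si : has_inf [set t | s <= F t].
  split; first by have [t] := real_cdf_y s1; exists t.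
  have [t tP] := real_cdf_Ny s0; exists t => u /= su.
  by rewrite leNgt; apply/negP => /ltW /real_cdf_nd /le_lt_trans /(_ tP); rewrite ltNge su.
apply/eqP; rewrite eq_le; apply/andP; split.
- apply: real_cdf_left => n; rewrite leNgt; apply/negP => /ltW Fs.
  have := ge_inf Si.2 Fs.
  by rewrite -/(Q s) lerBrDr gerDl leNgt invr_gt0 ltr0n.
- apply: real_cdf_right => n.
  have n0 : 0 < n.+1%:R^-1 :> R by rewrite invr_gt0.
  have [u /= su uQ] := inf_adherent n0 Si.
  exact: (le_trans su) (real_cdf_nd (ltW uQ)).
Qed.

(** This Galois connection turns preimages of rays under [Q] into rays, which gives both the
    measurability and the law of [Q]. *)
Lemma quantile_le s t : I s -> (Q s <= t) = (s <= F t).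
Proof.
move=> Is; apply/idP/idP => [/real_cdf_nd|st]; first by rewrite real_cdf_quantile.
move: Is; rewrite /= in_itv/= => /andP[s0 s1]; apply: ge_inf => //.
have [u uP] := real_cdf_Ny s0; exists u => v /= sv.
by rewrite leNgt; apply/negP => /ltW /real_cdf_nd /le_lt_trans /(_ uP); rewrite ltNge sv.
Qed.

(** If [Q s] had a neighbourhood outside [K], this would be null and [F] constant just left of
    [Q s]; then [F] would reach [s] strictly before [Q s], against [quantile_le]. *)
Lemma quantile_closed (K : set R) s : closed K -> m K = 1%E -> I s -> K (Q s).
Proof.
move=> cK mK1 Is; apply: contrapT => nK.
have mK : measurable (K : set (measurableTypeR R)) by exact: closed_measurable.
have := closed_openC cK; rewrite openE => /(_ _ nK) [e /= e0 eK].
have le0 : m `]-oo, Q s]%classic = m `]-oo, Q s - e / 2]%classic.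
  apply/eqP; rewrite eq_le; apply/andP; split; last first.
    by rewrite !real_cdfE lee_fin real_cdf_nd// gerBl divr_ge0// ltW.
  rewrite -[leRHS]adde0 -[X in (_ <= _ + X)%E](_ : m (~` K) = 0%E); last first.
    by rewrite probability_setC// mK1 subee.
  apply: (@le_trans _ _ (m (`]-oo, Q s - e / 2]%classic `|` ~` K))).
    apply: le_measure; rewrite ?inE//.
      by apply: measurableU => //; exact: measurableC.
    move=> x /=; rewrite !in_itv/= => xQ.
    have [|xe] := leP x (Q s - e / 2); [by left|right].
    apply: (eK x); rewrite /ball/= ltr_distlC; apply/andP; split.
      by apply: lt_trans xe; rewrite ltrD2l ltrN2 gtr_pMr// invf_lt1// ltr1n.
    by rewrite (le_lt_trans xQ)// ltrDl.
  by apply: measureU2 => //; exact: measurableC.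
move: le0; rewrite !real_cdfE => -[le0].
have := quantile_le (Q s - e / 2) Is; rewrite -/F -le0 real_cdf_quantile// lexx.
by rewrite lerDl oppr_ge0 leNgt divr_gt0.
Qed.

Lemma measurable_quantile : measurable_fun I Q.
Proof.
move=> mI; apply: (measurability _ (RGenOInfty.measurableE R)) => //.
move=> _ [_ [t ->] <-]; rewrite (_ : _ `&` _ = I `&` `]F t, +oo[%classic).
  exact: measurableI.
by apply/seteqP; split=> s [Is] /=; rewrite !in_itv/= !andbT => sP;
  split=> //; move: sP; rewrite !ltNge (quantile_le _ Is).
Qed.

Lemma measurable_real_cdf : measurable_fun setT F.
Proof. by apply: nondecreasing_measurable => //; exact: real_cdf_nd. Qed.

Lemma quantile_law (B : set (measurableTypeR R)) : measurable B ->
  lebesgue_measure (I `&` Q @^-1` B) = m B.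
Proof.
have I1 : lebesgue_measure I = 1%E.
  by rewrite lebesgue_measure_itv/= lte_fin ltr01 oppr0 adde0.
have I_gt0 : (0 < lebesgue_measure I)%E by rewrite I1.
have Ioo : (lebesgue_measure I < +oo)%E by rewrite I1 ltry.
(* [U] is the uniform law on [I]; below, [Q] gets a default value off [I], a set that [U] does not
   charge. *)
have [U UE] := @conditional_probability _ _ _ (@lebesgue_measure R) I
  (measurable_itv _) I_gt0 Ioo.
have mQ : measurable_fun setT (Q \_ I).
  have mI : measurable I by exact: measurable_itv.
  exact: (iffLR (measurable_restrictT _ mI) measurable_quantile).
have [P PE] := @pushforward_probability _ _ _ (measurableTypeR R) _ U _ mQ.
have {}PE (A : set (measurableTypeR R)) : P A = lebesgue_measure (I `&` Q @^-1` A).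
  rewrite PE UE [X in fine X]I1 invr1 mule1 setIC; congr lebesgue_measure.
  by apply/seteqP; split=> s [Is]; rewrite /= /patch mem_set.
move=> mB; rewrite -PE; apply: probability_ray_unique => //; last first.
  by move=> t; apply: (@le_lt_trans _ _ 1%E); [exact: probability_le1|exact: ltry].
move=> t; rewrite [LHS]PE [RHS]real_cdfE.
have -> : I `&` Q @^-1` `]-oo, t] = I `&` `]-oo, F t].
  by apply/seteqP; split=> s [Is] /=; rewrite !in_itv/= (quantile_le _ Is).
(* [F] may reach 1 at a finite [t]; the ray up to [F t] then contains all of [I]. *)
have [Ft1|] := ltP (F t) 1; last first.
  move=> Ft1; have -> : F t = 1 by apply/eqP; rewrite eq_le Ft1 real_cdf_le1.
  rewrite setIidl ?I1// => s /=; rewrite !in_itv/= => /andP[_ /ltW].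
  by [].
have -> : I `&` `]-oo, F t] = `]0, F t]%classic.
  apply/seteqP; split=> s /=; rewrite !in_itv/=; first by case=> /andP[->].
  by move=> /andP[-> sF]; rewrite (le_lt_trans sF).
rewrite lebesgue_measure_itv/= lte_fin oppr0 adde0.
case: ifPn => //; rewrite -leNgt => Ft0; congr EFin.
by apply/eqP; rewrite eq_le Ft0 real_cdf_ge0.
Qed.

(** The range of [Q] on [I] consists of the fixed points of [Q \o F] that [F] sends into [I], hence
    is Borel as an equalizer of measurable maps. *)
Lemma misom_quantile : exists J : set (measurableTypeR R),
  @misom _ _ (measurableTypeR R) (measurableTypeR R) I J Q F.
Proof.
exists (F @^-1` I `&` [set t | Q (F t) = t]).
have mFI : measurable (F @^-1` I).
  by rewrite -[X in measurable X]setTI; exact: measurable_real_cdf.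
have mJ : measurable (F @^-1` I `&` [set t | Q (F t) = t]).
  have := @measurable_fun_eqr _ _ _ (F @^-1` I) (Q \o F) id.
  move=> /(_ _ _ mFI [set true]) h.
  rewrite (_ : [set t | _] = (fun x => (Q \o F) x == id x) @^-1` [set true]).
    apply: h => //.
    apply: (measurable_comp (F := I)) => //; first by move=> _ [t + <-].
      exact: measurable_quantile.
    exact: measurable_funTS measurable_real_cdf.
  by apply/seteqP; split=> t /= /eqP.
split=> //.
- exact: measurable_quantile.
- exact: measurable_funTS measurable_real_cdf.
- by move=> s Is; rewrite /= real_cdf_quantile.
Qed.

End quantile.

(** * Modifications on null sets *)

Lemma measure_eq_off_null d (T : measurableType d) (R : realType)
    (m : {measure set T -> \bar R}) (A B N : set T) :
  measurable A -> measurable B -> measurable N -> m N = 0%E ->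
  A `\` N = B `\` N -> m A = m B.
Proof.
move=> mA mB mN N0 AB.
have off C : measurable C -> m C = m (C `\` N).
  move=> mC; rewrite -[in LHS](setUIDK C N) measureU//.
  - rewrite [X in (X + _)%E](_ : _ = 0%E) ?add0e//.
    by apply: subset_measure0 N0 => //; exact: measurableI.
  - exact: measurableI.
  - exact: measurableD.
  - by apply/seteqP; split=> x //= [[_ Nx] []].
by rewrite off// AB -off.
Qed.

Lemma probability_setC0 d (T : measurableType d) (R : realType)
    (P : probability T R) (A : set T) :
  measurable A -> P A = 1%E -> P (~` A) = 0%E.
Proof. by move=> mA PA; rewrite probability_setC// PA subee. Qed.

(** [f] is measurable on [E] only; its extension by a default value has the same law because [E] has
    full measure. *)
Lemma pushforward_on_probability d1 d2 (X : measurableType d1)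
    (Y : measurableType d2) (R : realType) (P : probability X R) (E : set X)
    (f : X -> Y) : measurable E -> P E = 1%E -> measurable_fun E f ->
  exists P' : probability Y R,
    forall A, measurable A -> P' A = P (E `&` f @^-1` A).
Proof.
move=> mE PE mf.
have mf' : measurable_fun setT (f \_ E) by apply/(measurable_restrictT f mE).
have [P' P'E] := pushforward_probability P mf'.
exists P' => A mA; rewrite P'E; apply: (@measure_eq_off_null _ _ _ _ _ _ (~` E)).
- by rewrite -[X in measurable X]setTI; exact: mf'.
- exact: mf.
- exact: measurableC.
- exact: probability_setC0.
- rewrite !setDE setCK; apply/seteqP; split=> x /=.
    by rewrite /patch => -[+ Ex]; rewrite mem_set.
  by rewrite /patch => -[[Ex +] _]; rewrite mem_set.
Qed.

(** * The unit interval and Borel sets carrying an atomless law *)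

Section unit_interval.
Variable R : realType.
Local Notation RR := (measurableTypeR R).
Local Notation I := (`]0, 1[%classic : set (measurableTypeR R)).
Local Notation lambda := (@lebesgue_measure R).

(** [Q] sends a set [D] of full Lebesgue measure in [I] into [E]. Inner regularity gives a compact
    [V] in [D] of positive measure, and the quantile function of the uniform law on [V] has its
    values in [V] by [quantile_closed]. Following it by [Q] lands in [E]. *)
Lemma misom_unit_into (m : probability RR R) (E : set RR) :
  (forall t : R, m [set t] = 0%E) -> measurable E -> m E = 1%E ->
  exists J f g, misom I J f g /\ J `<=` E.
Proof.
move=> m0 mE mE1.
have [J misoQ] := misom_quantile m0.
have [[mI mJ] mQ mF FQ QF] := misoQ.
set Q := quantile m in misoQ mQ FQ QF; set F := real_cdf m in misoQ mF FQ QF.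
pose D := I `&` Q @^-1` E.
have mD : measurable D by exact: mQ.
have D1 : lambda D = 1%E by rewrite quantile_law.
have Doo : (lambda D < +oo)%E by rewrite D1 ltry.
(* [D] has measure 1, so leaving out less than one half keeps [V] from being null. *)
have e0 : 0 < 2^-1 :> R by rewrite invr_gt0.
have [V [cV VD DV]] := lebesgue_regularity_inner mD Doo e0.
have clV : closed V by apply: compact_closed cV; exact: Rhausdorff.
have mV : measurable (V : set RR) by exact: closed_measurable.
have V0 : (0 < lambda V)%E.
  rewrite lt0e measure_ge0 andbT; apply/negP => /eqP V0.
  have DV1 : lambda (D `\` V) = 1%E.
    rewrite -D1; apply: (@measure_eq_off_null _ _ _ lambda _ _ V) => //.
    - exact: measurableD.
    - by rewrite setDDl setUid.
  have : (1 < (2^-1 : R)%:E)%E by rewrite -DV1; exact: DV.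
  by rewrite lte_fin ltNge invf_le1// ler1n.
have Voo : (lambda V < +oo)%E.
  by apply: le_lt_trans Doo; apply: le_measure; rewrite ?inE.
have [P PE] := @conditional_probability _ _ _ lambda _ mV V0 Voo.
have P0 (t : R) : P [set t] = 0%E.
  rewrite PE [X in (X * _)%E](_ : _ = 0%E) ?mul0e//.
  apply: (@subset_measure0 _ _ _ lambda _ [set t]).
  - by apply: measurableI => //; exact: measurable_set1.
  - exact: measurable_set1.
  - exact: subIsetl.
  - exact: lebesgue_measure_set1.
have PV : P V = 1%E.
  rewrite PE setIid -[X in (X * _)%E]fineK ?ge0_fin_numE ?measure_ge0//.
  rewrite -EFinM divff// gt_eqF// fine_gt0//.
  by apply/andP.
have [Jv misoV] := misom_quantile P0.
have [[_ mJv] _ _ _ QFv] := misoV.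
have JvV : Jv `<=` V.
  by move=> t /QFv [IFt <-]; exact: quantile_closed.
have JvI : Jv `<=` I by move=> t /JvV /VD [].
have misoS := misom_sub misoQ mJv JvI.
exists (J `&` F @^-1` Jv), (Q \o quantile P), (real_cdf P \o F); split.
  exact: misom_trans misoV misoS.
by move=> t [/QF [_ e] /JvV /VD [_ /=]]; rewrite e.
Qed.

(** The first bijection [h1] disregards the measures. Pulling [m] back along it gives an atomless
    law [m'] on [I], whose quantile function has the right law but may miss points of [I]. The
    second bijection repairs this by changing it only on the null set [E]. *)
Lemma misom_unit_null (m : probability RR R) (E : set RR) :
  (forall t : R, m [set t] = 0%E) -> measurable E -> m E = 1%E ->
  E `<=` I -> lambda E = 0%E ->
  exists h k, misom I E h k /\
    forall B, measurable B -> lambda (I `&` h @^-1` B) = m B.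
Proof.
move=> m0 mE mE1 EI E0.
have [B1 [q [q' [misoq B1E]]]] := misom_unit_into m0 mE mE1.
have [h1 [k1 [miso1 _]]] := misom_bernstein misoq B1E (misom_refl mE) EI.
have [[mI _] mh1 mk1 hk1 kh1] := miso1.
have [m' m'E] := pushforward_on_probability mE mE1 mk1.
have m'0 (t : R) : m' [set t] = 0%E.
  rewrite m'E; last exact: measurable_set1.
  apply: (@subset_measure0 _ _ _ m _ [set h1 t]).
  - by apply: mk1 => //; exact: measurable_set1.
  - exact: measurable_set1.
  - by move=> x [Ex /= <-]; have [_ ->] := kh1 _ Ex.
  - exact: m0.
have m'I : m' I = 1%E.
  by rewrite m'E// setIidl// => x /kh1[].
have [J' misoQ] := misom_quantile m'0.
have [[_ mJ'] mQ _ FQ QF] := misoQ.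
(* The distribution function of [m'] is 0 at 0 and 1 at 1, so quantiles of order [s] in [I] lie
   strictly between. *)
have J'I : J' `<=` I.
  move=> t /QF[+ <-]; move: (real_cdf m' t) => s Is.
  have Fs := real_cdf_quantile m'0 Is.
  have s01 := Is; rewrite /= in_itv/= in s01; have /andP[s0 s1] := s01.
  rewrite /= in_itv/=; apply/andP; split.
    rewrite ltNge quantile_le// -ltNge (le_lt_trans _ s0)//.
    rewrite -lee_fin -real_cdfE.
    apply: (@le_trans _ _ (m' (~` I))); last by rewrite (probability_setC0 mI m'I).
    apply: le_measure; rewrite ?inE//; first exact: measurableC.
    move=> x; rewrite /= !in_itv/= => x0; apply/negP.
    by rewrite negb_and -leNgt x0.
  rewrite ltNge; apply/negP => /(@real_cdf_nd _ m'); rewrite Fs.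
  apply/negP; rewrite -ltNge (lt_le_trans s1)// -lee_fin -real_cdfE -m'I.
  apply: le_measure; rewrite ?inE//.
  by move=> x; rewrite /= !in_itv/= => /andP[_ /ltW].
(* Here [h1] serves as an embedding of [I] into itself with image [E], so [h2] is the quantile
   function off [E]. *)
have [h2 [k2 [miso2 h2Q]]] := misom_bernstein misoQ J'I miso1 EI.
exists (h1 \o h2), (k2 \o k1); split; first exact: misom_trans miso2 miso1.
move=> B mB; have [_ mh2 _ hk2 _] := miso2.
pose C := I `&` h1 @^-1` B.
have mC : measurable C by exact: mh1.
have -> : I `&` (h1 \o h2) @^-1` B = I `&` h2 @^-1` C.
  by apply/seteqP; split=> x [Ix] => [|[]] //= ?; do !split => //; have [] := hk2 _ Ix.
transitivity (lambda (I `&` quantile m' @^-1` C)).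
  apply: (@measure_eq_off_null _ _ _ lambda _ _ E) => //.
  - exact: mh2.
  - exact: mQ.
  - apply/seteqP; split=> x [[Ix xC] nE]; split=> //; split=> //; move: xC.
      by rewrite /= h2Q.
    by rewrite /= h2Q.
rewrite quantile_law// m'E//.
transitivity (m (E `&` B)).
  congr (m _); apply/seteqP; split=> x [Ex].
    by case=> _ /=; have [_ ->] := kh1 _ Ex.
  by move=> Bx; split=> //; have [? e] := kh1 _ Ex; split=> //=; rewrite e.
apply: (@measure_eq_off_null _ _ _ m _ _ (~` E)) => //.
- exact: measurableI.
- exact: measurableC.
- exact: probability_setC0.
- by rewrite !setDE setCK; apply/seteqP; split=> x [] // []; do !split.
Qed.

End unit_interval.

(** * Bit sequences and a Lebesgue-null Cantor set *)

Definition bitcode :=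
  g_sigma_algebraType [set A : set (nat -> bool) | exists n, A = [set c | c n]].

Lemma measurable_code_bit n : measurable [set c : bitcode | c n].
Proof. by apply: sub_sigma_algebra; exists n. Qed.

Lemma measurable_fun_codeP d (X : measurableType d) (D : set X) (f : X -> bitcode) :
  (forall n, measurable (D `&` [set x | f x n])) -> measurable_fun D f.
Proof.
move=> mf mD; apply: measurability => //.
by move=> _ [_ [n ->] <-]; exact: mf.
Qed.

Section quaternary.
Variable R : realType.
Local Notation RR := (measurableTypeR R).

(* Expansions in base 4 with the digits 1 and 2: digit 0 is avoided so that the
   image stays inside ]0, 1[, and only two digits are used so that it is null. *)
Definition code_sum (n : nat) (c : nat -> bool) : R :=
  \sum_(i < n) (1 + (c i)%:R) / 4 ^+ i.+1.

Definition code_real (c : bitcode) : R := limn (fun n => code_sum n c).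

Definition code_shift (c : nat -> bool) : nat -> bool := fun n => c n.+1.

Lemma code_sumS n c : code_sum n.+1 c =
  (1 + (c 0%N)%:R + code_sum n (code_shift c)) / 4.
Proof.
rewrite /code_sum big_ord_recl [RHS]mulrDl expr1; congr (_ + _).
rewrite mulr_suml; apply: eq_bigr => i _.
by rewrite /code_shift /= /bump /= add1n [_ ^+ i.+2]exprS invfM mulrA mulrAC.
Qed.

(** [2 / 3] is the fixed point of [x |-> (2 + x) / 4], the step for the larger digit. *)
Lemma code_sum_bound n c : 0 <= code_sum n c <= 2 / 3.
Proof.
elim: n c => [|n IH] c; first by rewrite /code_sum big_ord0; lra.
by rewrite code_sumS; have := IH (code_shift c); case: (c 0%N) => /=; lra.
Qed.

Lemma code_sum_cvg c : code_sum n c @[n --> \oo] --> code_real c.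
Proof.
apply/cvg_ex; exists (sup (range (code_sum ^~ c))).
apply: nondecreasing_cvgn.
  apply/nondecreasing_seqP => n; rewrite /code_sum big_ord_recr/= lerDl.
  by rewrite divr_ge0// ?exprn_ge0// addr_ge0.
by exists (2 / 3) => _ [n _ <-]; have /andP[] := code_sum_bound n c.
Qed.

Lemma code_realS c : code_real c =
  (1 + (c 0%N)%:R + code_real (code_shift c)) / 4.
Proof.
have h1 : code_sum n.+1 c @[n --> \oo] --> code_real c.
  by rewrite (cvg_shiftS (code_sum ^~ c)); exact: code_sum_cvg.
have h2 : code_sum n.+1 c @[n --> \oo] -->
    (1 + (c 0%N)%:R + code_real (code_shift c)) / 4.
  under eq_fun do rewrite code_sumS.
  apply: cvgM; last exact: cvg_cst.
  by apply: cvgD; [exact: cvg_cst|exact: code_sum_cvg].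
exact: cvg_unique h1 h2.
Qed.

Lemma code_real_bound c : 0 <= code_real c <= 2 / 3.
Proof.
have cc := @code_sum_cvg c.
apply/andP; split.
  apply: limr_ge; first by apply/cvg_ex; eexists; exact: cc.
  by apply: nearW => n; have /andP[] := code_sum_bound n c.
apply: limr_le; first by apply/cvg_ex; eexists; exact: cc.
by apply: nearW => n; have /andP[] := code_sum_bound n c.
Qed.

Lemma code_real_unit c : 0 < code_real c < 1.
Proof.
by rewrite code_realS; have := code_real_bound (code_shift c);
   case: (c 0%N) => /=; lra.
Qed.

Lemma measurable_code_real : measurable_fun setT code_real.
Proof.
apply: (@measurable_fun_cvg _ bitcode R setT (code_sum : nat -> bitcode -> R));
  last by move=> c _; exact: code_sum_cvg.
move=> n; apply: measurable_sum => i.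
apply: measurable_funM => //; apply: measurable_funD => //.
rewrite (_ : (fun c => _) = (fun c : bitcode => if c i then 1 else 0)); last first.
  by apply/funext => c; case: (c i).
apply: measurable_fun_ifT => //; apply: (measurable_fun_bool true).
by rewrite setTI; exact: measurable_code_bit.
Qed.

(** The left shift read on expansions: a code with first digit 1 lies in [[1/4, 5/12]], one with
    first digit 2 in [[1/2, 2/3]], so comparison with [1/2] reveals the digit. *)
Definition real_shift (t : R) : R := 4 * t - 1 - (2^-1 <= t)%R%:R.

Definition real_code (t : R) : bitcode := fun n => 2^-1 <= iter n real_shift t.

Lemma real_shift_code c : real_shift (code_real c) = code_real (code_shift c).
Proof.
rewrite /real_shift code_realS; have := code_real_bound (code_shift c).
case: (c 0%N) => /= b; case: (leP 2^-1 _) => /= h; lra.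
Qed.

Lemma real_codeK : cancel code_real real_code.
Proof.
move=> c; apply/funext => n; rewrite /real_code.
elim: n c => [|n IH] c; last by rewrite iterSr real_shift_code IH.
rewrite /= code_realS; have := code_real_bound (code_shift c).
case: (c 0%N) => /= b; case: (leP 2^-1 _) => //= h; lra.
Qed.

Lemma measurable_real_shift : measurable_fun setT real_shift.
Proof.
apply: measurable_funB; first by apply: measurable_funB => //; exact: measurable_funM.
rewrite (_ : (fun t => _) = (fun t : R => if 2^-1 <= t then 1 else 0)); last first.
  by apply/funext => c; case: leP.
by apply: measurable_fun_ifT => //; exact: measurable_fun_ler.
Qed.

Lemma measurable_real_code : measurable_fun [set: RR] real_code.
Proof.
apply: measurable_fun_codeP => n; rewrite setTI.
have mi : measurable_fun [set: RR] (iter n real_shift).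
  elim: n => [|n IH] /=; first exact: measurable_id.
  exact: (measurableT_comp measurable_real_shift IH).
have := @measurable_fun_ler _ RR _ setT (cst 2^-1) _ (@measurable_cst _ _ _ _ _ _) mi.
move=> /(_ measurableT [set true]); rewrite setTI; exact.
Qed.

(** The contractions [t |-> (1 + t) / 4] and [t |-> (2 + t) / 4] double the number of intervals and
    quarter their length; the total length [2^n * 4^-n] tends to 0. *)
Lemma code_real_cover n : exists2 L : seq R, size L = (2 ^ n)%N &
  forall c, exists2 a, a \in L & a <= code_real c <= a + 4 ^- n.
Proof.
elim: n => [|n [L sL LP]].
  exists [:: 0] => // c; exists 0; first by rewrite inE.
  by have := code_real_bound c; rewrite expr0 invr1; lra.
exists ([seq (1 + a) / 4 | a <- L] ++ [seq (2 + a) / 4 | a <- L]).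
  by rewrite size_cat !size_map sL addnn -mul2n -expnS.
move=> c; have [a aL aP] := LP (code_shift c).
have e : (4 ^- n.+1 : R) = 4 ^- n / 4 by rewrite exprS invfM mulrC.
exists ((1 + (c 0%N)%:R + a) / 4).
  rewrite mem_cat; case: (c 0%N) => /=; apply/orP; [right|left]; apply/mapP;
  by exists a => //; congr (_ / _); rewrite ?addr0.
by rewrite code_realS e; move: aP; move: (4 ^- n); case: (c 0%N) => /= x; lra.
Qed.

Lemma lebesgue_cover (r : R) (L : seq R) : 0 <= r ->
  let U := [set t : RR | exists2 a, a \in L & a <= t <= a + r] in
  measurable U /\ (lebesgue_measure U <= ((size L)%:R * r)%:E)%E.
Proof.
move=> r0; elim: L => [|a L [mU IH]] /=.
  rewrite (_ : [set t | _] = set0) ?measure0 ?mul0r//.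
  by apply/seteqP; split=> t //= [].
set U := [set t : RR | exists2 a, a \in L & _] in mU IH.
rewrite (_ : [set t | _] = `[a, a + r]%classic `|` U); last first.
  apply/seteqP; split=> t /=.
    case=> b; rewrite inE => /orP[/eqP->|bL] h; [left|right]; first by rewrite in_itv.
    by exists b.
  case=> [|[b bL h]]; first by rewrite in_itv/= => h; exists a; rewrite ?inE ?eqxx.
  by exists b => //; rewrite inE bL orbT.
split; first exact: measurableU.
apply: (@le_trans _ _ (lebesgue_measure (`[a, (a + r)%R]%classic : set RR) +
                       lebesgue_measure U)%E); first exact: measureU2.
rewrite -natr1 mulrDl mul1r addrC EFinD; apply: leeD => //.
by rewrite lebesgue_measure_itv/=; case: ifPn; rewrite lee_fin// => _; lra.
Qed.

(** The range of [code_real], written as a fixed-point set so that it is Borel as an equalizer. *)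
Definition cantor_set : set RR := [set t | code_real (real_code t) = t].

Lemma misom_cantor : misom [set: bitcode] cantor_set code_real real_code.
Proof.
have mc : measurable cantor_set.
  have := @measurable_fun_eqr _ RR _ setT (code_real \o real_code) id.
  move=> /(_ (measurableT_comp measurable_code_real measurable_real_code)).
  move=> /(_ (@measurable_id _ _ _) measurableT [set true]).
  rewrite setTI (_ : _ @^-1` _ = cantor_set); first by apply.
  by apply/seteqP; split=> t /= /eqP.
split=> //.
- exact: measurable_code_real.
- exact: measurable_funTS measurable_real_code.
- by move=> c _; rewrite /cantor_set /= real_codeK.
Qed.

Lemma cantor_set_unit : cantor_set `<=` `]0, 1[%classic.
Proof. by move=> t /= <-; rewrite in_itv/= code_real_unit. Qed.

Lemma cantor_set_null : lebesgue_measure cantor_set = 0%E.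
Proof.
have [[_ mc] _ _ _ _] := misom_cantor.
apply/eqP; rewrite eq_le measure_ge0 andbT.
apply/lee_addgt0Pr => e e0; rewrite add0e.
have [n ne] : exists n, (2 ^+ n)^-1 < e.
  have h : `|2^-1 : R| < 1 by rewrite ger0_norm// invf_lt1// ltr1n.
  have /cvgrPdist_lt /(_ e e0) [n _ /(_ n (leqnn n))] := cvg_expr h.
  rewrite sub0r normrN exprVn ger0_norm ?invr_ge0 ?exprn_ge0// => ne.
  by exists n.
have [L sL LP] := code_real_cover n.
have r0 : 0 <= 4 ^- n :> R by rewrite invr_ge0 exprn_ge0.
have [mU UL] := lebesgue_cover L r0.
apply: (@le_trans _ _ (2 ^+ n)^-1%:E); last by rewrite lee_fin ltW.
apply: (le_trans _ (le_trans UL _)).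
  apply: (@le_measure _ _ _ lebesgue_measure); rewrite ?inE//.
  by move=> t /= tE; have := LP (real_code t); rewrite tE.
rewrite lee_fin sL natrX -[4]/((2 * 2)%:R : R) natrM exprMn invfM mulrA divff ?mul1r//.
Qed.

End quaternary.

(** * Standard Borel spaces and their products *)

(** [misom] includes the measurability of [E]. Coding in Cantor space rather than in the line makes
    products easy: the bits of two codes are interleaved. *)
Definition standard_borel d (X : measurableType d) : Prop :=
  exists (E : set bitcode) f g, misom [set: X] E f g.

Lemma measurable_fun_pair_on d1 d2 d3 (T : measurableType d1)
    (X : measurableType d2) (Y : measurableType d3) (D : set T)
    (f : T -> X) (g : T -> Y) : measurable_fun D f -> measurable_fun D g ->
  measurable_fun D (fun x => (f x, g x)).
Proof.
move=> mf mg mD; apply: (@measurability _ _ _ (X * Y)%type _ _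
  (preimage_set_system setT fst measurable `|`
   preimage_set_system setT snd measurable)) => //.
by move=> _ [_ [[A mA <-]|[A mA <-]] <-]; rewrite setTI; [exact: mf|exact: mg].
Qed.

Lemma misom_prod d1 d2 d3 d4 (X : measurableType d1) (Y : measurableType d2)
    (X' : measurableType d3) (Y' : measurableType d4)
    (A : set X) (B : set Y) (A' : set X') (B' : set Y') f g f' g' :
  misom A B f g -> misom A' B' f' g' ->
  misom (A `*` A') (B `*` B') (fun x => (f x.1, f' x.2))
    (fun y => (g y.1, g' y.2)).
Proof.
move=> [[mA mB] mf mg fg gf] [[mA' mB'] mf' mg' fg' gf'].
have mAA : measurable (A `*` A') by exact: measurableX.
have mBB : measurable (B `*` B') by exact: measurableX.
split=> //.
- apply: measurable_fun_pair_on.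
    apply: (measurable_comp (F := A)) => //; last exact: measurable_funTS measurable_fst.
    by move=> _ [x [? _] <-].
  apply: (measurable_comp (F := A')) => //; last exact: measurable_funTS measurable_snd.
  by move=> _ [x [_ ?] <-].
- apply: measurable_fun_pair_on.
    apply: (measurable_comp (F := B)) => //; last exact: measurable_funTS measurable_fst.
    by move=> _ [x [? _] <-].
  apply: (measurable_comp (F := B')) => //; last exact: measurable_funTS measurable_snd.
  by move=> _ [x [_ ?] <-].
- by move=> [x x'] /= [/fg[? ->] /fg'[? ->]].
- by move=> [x x'] /= [/gf[? ->] /gf'[? ->]].
Qed.

Lemma misom_code_prod : misom [set: bitcode * bitcode] [set: bitcode]
  (fun c => (fun n => if odd n then c.2 n./2 else c.1 n./2) : bitcode)
  (fun c => ((fun n => c n.*2) : bitcode, (fun n => c n.*2.+1) : bitcode)).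
Proof.
split=> //.
- apply: measurable_fun_codeP => n; rewrite setTI.
  case: (odd n).
    rewrite (_ : [set _ | _] = snd @^-1` [set c : bitcode | c n./2]); last first.
      by [].
    by rewrite -[X in measurable X]setTI; apply: measurable_snd => //; exact: measurable_code_bit.
  rewrite (_ : [set _ | _] = fst @^-1` [set c : bitcode | c n./2]); last first.
    by [].
  by rewrite -[X in measurable X]setTI; apply: measurable_fst => //; exact: measurable_code_bit.
- by apply: measurable_fun_pair; apply: measurable_fun_codeP => n; rewrite setTI;
    exact: measurable_code_bit.
- move=> [c c'] _ /=; split=> //; congr pair; apply/funext => n.
    by rewrite odd_double doubleK.
  by rewrite /= odd_double /= uphalf_double.
- move=> c _ /=; split=> //; apply/funext => n.
  by have := odd_double_half n; case: (odd n) => /= e;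
    rewrite -[in RHS]e.
Qed.

Lemma standard_borel_prod d1 d2 (X : measurableType d1) (Y : measurableType d2) :
  standard_borel X -> standard_borel Y -> standard_borel (X * Y)%type.
Proof.
move=> [E [f [g fg]]] [E' [f' [g' fg']]].
have fgp := misom_prod fg fg'; have [[_ mEE] _ _ _ _] := fgp.
have := misom_trans fgp (misom_sub misom_code_prod mEE (@subsetT _ _)).
by rewrite setXTT => h; do 3 eexists; exact: h.
Qed.

(** * The isomorphism theorem for atomless laws, respecting countable labels *)

Section isomorphism.
Variable R : realType.
Local Notation RR := (measurableTypeR R).
Local Notation I := (`]0, 1[%classic : set (measurableTypeR R)).
Local Notation lambda := (@lebesgue_measure R).

Lemma standard_borel_null d (X : measurableType d) : standard_borel X ->
  exists (E : set RR) f g, [/\ misom [set: X] E f g, E `<=` I & lambda E = 0%E].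
Proof.
move=> [E [f [g fg]]]; have [[_ mE] _ _ _ _] := fg.
have fg' := misom_sub (misom_cantor R) mE (@subsetT _ _).
have fg'' := misom_trans fg fg'; have [[_ mE'] _ _ _ _] := fg''.
have [[_ mc] _ _ _ _] := misom_cantor R.
do 3 eexists; split; first exact: fg''.
- by move=> t [/cantor_set_unit].
- apply: (@subset_measure0 _ _ _ lambda _ (@cantor_set R)) => //.
  exact: cantor_set_null.
Qed.

Lemma standard_borel_set1 d (X : measurableType d) (x : X) :
  standard_borel X -> measurable [set x].
Proof.
move=> /standard_borel_null[E [f [g [[_ mf _ fgK _] _ _]]]].
rewrite (_ : [set x] = f @^-1` [set f x]).
  rewrite -[X in measurable X]setTI.
  by apply: mf => //; exact: measurable_set1.
apply/seteqP; split=> y /= e; first by rewrite e.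
by have [_ <-] := fgK y Logic.I; rewrite e; have [_ ->] := fgK x Logic.I.
Qed.

(** The code carries the conditional law of [P] on [A] to a null Borel subset of [I], where
    [misom_unit_null] applies; the factor [P A] undoes the normalization. *)
Lemma misom_unit d (X : measurableType d) (P : probability X R) (A : set X) :
  standard_borel X -> (forall x, P [set x] = 0%E) -> measurable A ->
  (0 < P A)%E ->
  exists h k, misom I A h k /\
    forall B, measurable B -> (P A * lambda (I `&` h @^-1` B))%E = P (A `&` B).
Proof.
move=> sX P0 mA PA; have [E [f [g [fg EI E0]]]] := standard_borel_null sX.
have PAoo : (P A < +oo)%E.
  by apply: (@le_lt_trans _ _ 1%E); [exact: probability_le1|exact: ltry].
have [[_ mE] mf mg fgK gfK] := fg.
have [PA' PA'E] := @conditional_probability _ _ _ P _ mA PA PAoo.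
have [m mE'] := pushforward_probability PA' mf.
have {}mE' B : m B = (P (f @^-1` B `&` A) * ((fine (P A))^-1)%:E)%E.
  by rewrite mE' PA'E.
have m0 (t : R) : m [set t] = 0%E.
  rewrite mE' [X in (X * _)%E](_ : _ = 0%E) ?mul0e//.
  have gE : f @^-1` [set t] `&` A `<=` [set g t].
    by move=> x [/= <- _]; have [_ ->] := fgK x Logic.I.
  apply: (@subset_measure0 _ _ _ P _ [set g t]) => //.
  - apply: measurableI => //; rewrite -[X in measurable X]setTI.
    by apply: mf => //; exact: measurable_set1.
  - exact: standard_borel_set1.
  - exact: P0.
have fgA := misom_sub fg mA (@subsetT _ _).
set EA := _ `&` _ in fgA; have [[_ mEA] _ _ fgAK gfAK] := fgA.
have mEA1 : m EA = 1%E.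
  rewrite mE' (_ : _ `&` A = A).
    rewrite -[X in (X * _)%E]fineK ?ge0_fin_numE ?measure_ge0//.
    by rewrite -EFinM divff// gt_eqF// fine_gt0// PA.
  by apply/seteqP; split=> x; [case|move=> Ax; split=> //; have [] := fgAK _ Ax].
have EA0 : lambda EA = 0%E.
  by apply: (@subset_measure0 _ _ _ lambda _ E) => //; exact: subIsetl.
have EAI : EA `<=` I by move=> u [Eu _]; exact: EI.
have [h [k [hk hE]]] := misom_unit_null m0 mEA mEA1 EAI EA0.
exists (g \o h), (k \o f); split; first exact: misom_trans hk (misom_sym fgA).
move=> B mB; have [_ mh mk hkK khK] := hk.
have mgB : measurable (EA `&` g @^-1` B).
  rewrite /EA -setIA -preimage_setI; apply: mg => //; exact: measurableI.
rewrite (_ : I `&` (g \o h) @^-1` B = I `&` h @^-1` (EA `&` g @^-1` B)); last first.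
  by apply/seteqP; split=> [t [It Bt]|t [It [_ Bt]]]; split=> //; split=> //;
    have [] := hkK _ It.
rewrite hE// mE' (_ : _ `&` A = A `&` B); last first.
  apply/seteqP; split=> [x [[_ /= Bx] Ax]|x [Ax Bx]].
    by split=> //; have [_ <-] := fgAK _ Ax.
  by split=> //; have [? e] := fgAK _ Ax; split=> //=; rewrite e.
rewrite muleCA -[X in (_ * (X * _))%E]fineK ?ge0_fin_numE ?measure_ge0//.
by rewrite -EFinM divff ?mule1// gt_eqF// fine_gt0// PA.
Qed.

Lemma measure_label_sum d (X : measurableType d) (P : {measure set X -> \bar R})
    (a : X -> nat) (A : set X) : measurable_fun setT a -> measurable A ->
  P A = (\sum_(i <oo) P (a @^-1` [set i] `&` A))%E.
Proof.
move=> ma mA.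
have mai i : measurable (a @^-1` [set i]).
  by rewrite -[X in measurable X]setTI; exact: ma.
rewrite [LHS](_ : _ = P (\bigcup_i (a @^-1` [set i] `&` A))); last first.
  congr (P _); apply/seteqP; split=> [x Ax|x [i _ []]//].
  by exists (a x).
rewrite measure_bigcup.
- by apply: eq_eseriesl => i; rewrite in_setT.
- by move=> i _; exact: measurableI.
- apply/trivIsetP => i j _ _ ij; apply/seteqP; split=> x //= [[-> _] [e _]].
  by rewrite e eqxx in ij.
Qed.

(** Cells of positive mass are matched through [I], each side being the image of Lebesgue measure
    scaled by the same mass. Null cells with equal labels need not be isomorphic, so they are merged
    into one cell of positive mass; hence labels are kept only off a null set. *)
Lemma label_misom d1 d2 (X : measurableType d1) (Z : measurableType d2)
    (P : probability X R) (P' : probability Z R) (a : X -> nat) (b : Z -> nat) :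
  standard_borel X -> standard_borel Z ->
  (forall x, P [set x] = 0%E) -> (forall z, P' [set z] = 0%E) ->
  measurable_fun setT a -> measurable_fun setT b ->
  (forall J : set nat, P (a @^-1` J) = P' (b @^-1` J)) ->
  exists S S', [/\ misom setT setT S S',
    forall B, measurable B -> P (S @^-1` B) = P' B &
    exists N, [/\ measurable N, P N = 0%E &
      forall x, ~ N x -> a x = b (S x)]].
Proof.
move=> sX sZ P0 P'0 ma mb ab.
have maJ J : measurable (a @^-1` J).
  by rewrite -[X in measurable X]setTI; exact: ma.
have mbJ J : measurable (b @^-1` J).
  by rewrite -[X in measurable X]setTI; exact: mb.
pose null := [set i | P (a @^-1` [set i]) = 0%E].
have Pnull : P (a @^-1` null) = 0%E.
  rewrite (measure_label_sum P ma)//; apply: eseries0 => i _ _.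
  have [ni|ni] := pselect (null i).
    by apply: subset_measure0 ni => //; exact: measurableI.
  rewrite (_ : _ `&` _ = set0) ?measure0//.
  by apply/seteqP; split=> x //= [->].
(* Otherwise countably many null cells would cover [X]. *)
have [i0 ni0] : exists i, ~ null i.
  apply: contrapT => /forallNP h.
  have : P (a @^-1` null) = 1%E.
    rewrite -(probability_setT P); congr (P _); apply/seteqP; split=> // x _.
    by apply: contrapT; exact: h.
  by rewrite Pnull => /esym/eqP; rewrite onee_eq0.
(* After relabelling by [r] every cell is either empty or of positive mass. *)
pose r i := if i \in null then i0 else i.
have rE i : ~ null i -> r i = i by move=> ni; rewrite /r memNset.
have rN i : ~ null (r i).
  by rewrite /r; case: ifPn => [//|/negP h ?]; apply: h; rewrite inE.
have cellP i : exists fg : (X -> Z) * (Z -> X),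
    misom ((r \o a) @^-1` [set i]) ((r \o b) @^-1` [set i]) fg.1 fg.2 /\
    forall B, measurable B -> P ((r \o a) @^-1` [set i] `&` fg.1 @^-1` B) =
      P' ((r \o b) @^-1` [set i] `&` B).
  have [ni|ni] := pselect (null i).
    have ea : (r \o a) @^-1` [set i] = set0.
      by apply/seteqP; split=> x //= e; apply: (rN (a x)); rewrite e.
    have eb : (r \o b) @^-1` [set i] = set0.
      by apply/seteqP; split=> x //= e; apply: (rN (b x)); rewrite e.
    exists (fun=> point, fun=> point); rewrite ea eb; split=> /=.
      by split => //; exact: measurable_fun_set0.
    by move=> B _; rewrite !set0I !measure0.
  pose A := (r \o a) @^-1` [set i]; pose B := (r \o b) @^-1` [set i].
  have mA : measurable A by exact: (maJ (r @^-1` [set i])).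
  have mB : measurable B by exact: (mbJ (r @^-1` [set i])).
  have PAB : P A = P' B by exact: (ab (r @^-1` [set i])).
  have PA0 : (0 < P A)%E.
    rewrite lt0e measure_ge0 andbT; apply/eqP => PA; apply: (ni).
    apply: subset_measure0 PA => //.
    by move=> x /= e; rewrite /A /= e; exact: rE.
  have PB0 : (0 < P' B)%E by rewrite -PAB.
  have [h [k [hk hE]]] := misom_unit sX P0 mA PA0.
  have [h' [k' [hk' hE']]] := misom_unit sZ P'0 mB PB0.
  exists (h' \o k, h \o k'); split.
    exact: misom_trans (misom_sym hk) hk'.
  move=> D mD; rewrite -/A -/B -hE' // -PAB.
  have [_ _ mk hkK khK] := hk; have [_ mh' _ _ _] := hk'.
  have mAD : measurable (A `&` (h' \o k) @^-1` D).
    have -> : A `&` (h' \o k) @^-1` D = A `&` k @^-1` (I `&` h' @^-1` D).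
      by apply/seteqP; split=> [x [Ax Dx]|x [Ax [_ Dx]]]; split=> //; split=> //;
        have [] := khK _ Ax.
    by apply: mk => //; exact: mh'.
  rewrite /= -[A `&` _](setIidr (@subIsetl _ A ((h' \o k) @^-1` D))) -hE//.
  congr (_ * lambda _)%E; apply/seteqP; split=> [t [It [_ /=]]|t [It Dt]].
    by have [_ ->] := hkK _ It.
  by split=> //; have [? e] := hkK _ It; split=> //=; rewrite e.
have [F FP] := choice cellP.
pose S x := (F (r (a x))).1 x; pose S' z := (F (r (b z))).2 z.
have mS : misom setT setT S S'.
  apply: (@misom_glue _ _ _ _ (r \o a) (r \o b) (fun i => (F i).1) (fun i => (F i).2)).
  by move=> i; have [] := FP i.
have [_ mfS _ _ _] := mS.
have mpS D : measurable D -> measurable (S @^-1` D).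
  by move=> mD; rewrite -[X in measurable X]setTI; exact: mfS.
have PS D : measurable D -> P (S @^-1` D) = P' D.
  move=> mD; rewrite (@measure_label_sum _ _ P (r \o a))//; last exact: mpS.
    rewrite (@measure_label_sum _ _ P' (r \o b))//.
      apply: eq_eseriesr => i _; have [_ FE] := FP i.
      apply: etrans (FE _ mD).
      by congr (P _); apply/seteqP; split=> x [/= e]; rewrite /S /= e.
    exact: measurableT_comp.
  exact: measurableT_comp.
exists S, S'; split=> //.
(* Off this set neither the label of [x] nor that of [S x] is null, so [r] fixes both, and the
   matching of cells makes them equal. *)
exists (a @^-1` null `|` S @^-1` (b @^-1` null)); split.
- by apply: measurableU => //; exact: mpS.
- apply/eqP; rewrite eq_le measure_ge0 andbT.
  apply: (le_trans (measureU2 _ _ _)) => //; first exact: mpS.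
  by rewrite [X in (X + _)%E]Pnull [X in (_ + X)%E]PS// add0e -ab Pnull.
- move=> x /not_orP[/= na nb]; rewrite -(rE _ na) -(rE _ nb).
  have [[_ _ _ h _] _] := FP (r (a x)).
  by have [//|/= ->] := h x.
Qed.

End isomorphism.

(** * Measurability of predicates on bit sequences *)

Section bitcode_predicates.
Implicit Types p q : bitcode -> Prop.

Lemma measurable_bitcode_cst (P : Prop) : measurable [set c : bitcode | P].
Proof.
have [p|np] := pselect P.
  by rewrite [X in measurable X](_ : _ = [set: bitcode])//; apply/seteqP; split.
by rewrite [X in measurable X](_ : _ = (set0 : set bitcode))//; apply/seteqP; split.
Qed.

Lemma measurable_bitcode_imp p q : measurable [set c | p c] ->
  measurable [set c | q c] -> measurable [set c | p c -> q c].
Proof.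
move=> mp mq; rewrite (_ : [set c | _] = ~` [set c | p c] `|` [set c | q c]).
  by apply: measurableU => //; exact: measurableC.
apply/seteqP; split=> c /=; last by case.
by move=> pq; have [/pq|] := pselect (p c); [right|left].
Qed.

Lemma measurable_bitcode_and p q : measurable [set c | p c] ->
  measurable [set c | q c] -> measurable [set c | p c /\ q c].
Proof. by move=> mp mq; exact: measurableI. Qed.

Lemma measurable_bitcode_all (p : nat -> bitcode -> Prop) :
  (forall n, measurable [set c | p n c]) -> measurable [set c | forall n, p n c].
Proof.
move=> mp; rewrite (_ : [set c | _] = \bigcap_n [set c | p n c]).
  exact: bigcapT_measurable.
by apply/seteqP; split=> c /= h n; [move=> _; exact: h|exact: h].
Qed.

Lemma measurable_bitcode_ex (p : nat -> bitcode -> Prop) :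
  (forall n, measurable [set c | p n c]) ->
  measurable [set c | exists n, p n c].
Proof.
move=> mp; rewrite (_ : [set c | _] = \bigcup_n [set c | p n c]).
  exact: bigcupT_measurable.
by apply/seteqP; split=> c /= [n]; [exists n|move=> _; exists n].
Qed.

End bitcode_predicates.

(** * Polish spaces are standard Borel *)

Section metric.
Variables (R : realType) (X : ptopologicalType) (d : X -> X -> R).
Hypothesis dX : compatible_metric d.

Lemma cmetric_ge0 x y : 0 <= d x y.
Proof. by have [[h _] _] := dX. Qed.

Lemma cmetric_refl x : d x x = 0.
Proof. by have [[_ [h _]] _] := dX; apply/h. Qed.

Lemma cmetric_eq0 x y : d x y = 0 -> x = y.
Proof. by have [[_ [h _]] _] := dX; move/h. Qed.

Lemma cmetric_sym x y : d x y = d y x.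
Proof. by have [[_ [_ [h _]]] _] := dX. Qed.

Lemma cmetric_triangle x y z : d x z <= d x y + d y z.
Proof. by have [[_ [_ [_ h]]] _] := dX. Qed.

Lemma cmetric_openP (A : set X) : open A <->
  forall x, A x -> exists2 e : R, 0 < e & forall y, d x y < e -> A y.
Proof. by have [_] := dX; exact. Qed.

Lemma open_metric_ball x r : open [set y | d x y < r].
Proof.
apply/cmetric_openP => y /= xy; exists (r - d x y); first by rewrite subr_gt0.
by move=> z yz; have := cmetric_triangle x y z; lra.
Qed.

Lemma cmetric_nbhs x (A : set X) : nbhs x A ->
  exists2 e : R, 0 < e & forall y, d x y < e -> A y.
Proof.
rewrite nbhsE => -[B [oB Bx] BA]; move/cmetric_openP: oB => /(_ _ Bx) [e e0 eB].
by exists e => // y /eB /BA.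
Qed.

Lemma measurable_metric x : measurable_fun [set: borel X] (d x).
Proof.
move=> mT; apply: (measurability _ (RGenInftyO.measurableE R)) => //.
move=> _ [_ [t ->] <-]; rewrite setTI; apply: sub_sigma_algebra.
rewrite (_ : _ @^-1` _ = [set y | d x y < t]); first exact: open_metric_ball.
by apply/seteqP; split=> y /=; rewrite in_itv.
Qed.

Definition ball_basis (t : nat -> X) (r : nat -> R) : Prop :=
  forall x e, 0 < e -> exists n, r n < e /\ d (t n) x < r n.

Lemma separable_ball_basis : separable_space X -> exists t r, ball_basis t r.
Proof.
move=> [s sP].
(* [u] enumerates pairs of a centre and a radius index; integers coding no pair get [(0, 0)]. *)
pose u n := odflt (0%N, 0%N) (unpickle n : option (nat * nat)).
exists (fun n => s (u n).1), (fun n => (u n).2.+1%:R^-1) => x e e0.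
pose k := Num.truncn e^-1.
have k0 : 0 < k.+1%:R^-1 :> R by rewrite invr_gt0.
have [|i ix] := sP _ (open_metric_ball x k.+1%:R^-1).
  by exists x => /=; rewrite cmetric_refl.
exists (pickle (i, k)); rewrite /u pickleK /=; split; last by rewrite cmetric_sym; exact: ix.
by rewrite invf_plt ?posrE// truncnS_gt.
Qed.

Section basis.
Variables (t : nat -> X) (r : nat -> R).
Hypothesis tr : ball_basis t r.

Lemma ball_basis_open (U : set X) x : open U -> U x ->
  exists n, d (t n) x < r n /\ forall y, d (t n) y < r n -> U y.
Proof.
move=> /cmetric_openP oU /oU [e e0 eU].
have [|n [re tx]] := tr x (e := e / 2); first by rewrite divr_gt0.
exists n; split=> // y ty; apply: eU.
by have := cmetric_triangle x (t n) y; rewrite (cmetric_sym x (t n)); lra.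
Qed.

(** The centres are dense, so [d x y < q] iff [d (t n) x + d (t n) y < q] for some [n]; each of
    these conditions is measurable for the product sigma-algebra. *)
Lemma measurable_dist :
  measurable_fun [set: borel X * borel X] (fun p => d p.1 p.2).
Proof.
move=> mT; apply: (measurability _ (RGenInftyO.measurableE R)) => //.
move=> _ [_ [q ->] <-]; rewrite setTI.
rewrite (_ : _ @^-1` _ = \bigcup_n [set p | d (t n) p.1 + d (t n) p.2 < q]).
  apply: bigcupT_measurable => n; rewrite -[X in measurable X]setTI.
  have mf : measurable_fun [set: borel X * borel X]
      (fun p => d (t n) p.1 + d (t n) p.2).
    apply: measurable_funD.
      exact: (measurableT_comp (@measurable_metric (t n)) measurable_fst).
    exact: (measurableT_comp (@measurable_metric (t n)) measurable_snd).
  rewrite (_ : [set p | _] = (fun p => d (t n) p.1 + d (t n) p.2) @^-1` `]-oo, q[).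
    exact: (mf mT _ (@measurable_itv R `]-oo, q[)).
  by apply/seteqP; split=> p /=; rewrite in_itv.
apply/seteqP; split=> [[x y] /=|[x y] [n _] /=]; rewrite in_itv/= => xy.
  have [|n [re tx]] := tr x (e := (q - d x y) / 2).
    by rewrite divr_gt0// subr_gt0.
  by exists n => //=; have := cmetric_triangle (t n) x y; lra.
by apply: le_lt_trans xy; rewrite (cmetric_sym (t n) x); exact: cmetric_triangle.
Qed.

(** The label of [x] is the least [n] with [t n] within [e / 2] of [x]; each cell is a ball minus
    finitely many balls. *)
Lemma small_cells (e : R) : 0 < e -> exists a : borel X -> nat,
  measurable_fun setT a /\ forall x y, a x = a y -> d x y < e.
Proof.
move=> e0; have ex x : exists n, d (t n) x < e / 2.
  have [|n [re tx]] := tr x (e := e / 2); first by rewrite divr_gt0.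
  by exists n; apply: lt_trans re.
pose a x := ex_minn (ex x).
have aP x : d (t (a x)) x < e / 2 by rewrite /a; case: ex_minnP.
have a_min x n : d (t n) x < e / 2 -> (a x <= n)%N.
  by rewrite /a; case: ex_minnP => m _; exact.
have mball n : measurable ([set x | d (t n) x < e / 2] : set (borel X)).
  by apply: sub_sigma_algebra; exact: open_metric_ball.
exists a; split; last first.
  move=> x y axy; have := aP x; have := aP y; rewrite -axy.
  by have := cmetric_triangle x (t (a x)) y; rewrite (cmetric_sym x (t (a x))); lra.
move=> _ J _; rewrite setTI.
rewrite (_ : a @^-1` J = \bigcup_(i in J) ([set x | d (t i) x < e / 2] `\`
    \bigcup_(j in `I_i) [set x | d (t j) x < e / 2])).
  apply: bigcup_measurable => i _; apply: measurableD => //.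
  by apply: bigcup_measurable.
apply/seteqP; split=> [x /= Jx|x [i Ji [xi nj]] /=].
  exists (a x) => //; split; first exact: aP.
  by case=> j /= ja /a_min; rewrite leqNgt ja.
suff -> : a x = i by [].
apply/eqP; rewrite eqn_leq a_min//= leqNgt; apply/negP => ai.
by apply: nj; exists (a x) => //; exact: aP.
Qed.

Let balls (x : borel X) : bitcode := fun n => d (t n) x < r n.

(* When the metric is complete, these countably many conditions say that c is
   exactly the set of indices of the balls containing some point. *)
Let coherent : set bitcode := [set c |
  [/\ forall k : nat, exists n, c n /\ r n < k.+1%:R^-1,
      forall n m, c n -> c m -> d (t n) (t m) < r n + r m &
      forall n, (c n -> exists m, c m /\ d (t n) (t m) + r m < r n) /\
                ((exists m, c m /\ d (t n) (t m) + r m < r n) -> c n)]].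

Let measurable_coherent : measurable coherent.
Proof.
rewrite (_ : coherent = [set c : bitcode |
  (forall k : nat, exists n, c n /\ r n < k.+1%:R^-1) /\
  ((forall n m, c n -> c m -> d (t n) (t m) < r n + r m) /\
   forall n, (c n -> exists m, c m /\ d (t n) (t m) + r m < r n) /\
                ((exists m, c m /\ d (t n) (t m) + r m < r n) -> c n))]); last first.
  by apply/seteqP; split=> [c [? ? ?]|c [? [? ?]]].
have mex n : measurable
    [set c : bitcode | exists m, c m /\ d (t n) (t m) + r m < r n].
  apply: measurable_bitcode_ex => m; apply: measurable_bitcode_and.
    exact: measurable_code_bit.
  exact: measurable_bitcode_cst.
apply: measurable_bitcode_and.
  apply: measurable_bitcode_all => k; apply: measurable_bitcode_ex => n.
  apply: measurable_bitcode_and; first exact: measurable_code_bit.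
  exact: measurable_bitcode_cst.
apply: measurable_bitcode_and.
  apply: measurable_bitcode_all => n; apply: measurable_bitcode_all => m.
  apply: measurable_bitcode_imp; first exact: measurable_code_bit.
  apply: measurable_bitcode_imp; first exact: measurable_code_bit.
  exact: measurable_bitcode_cst.
apply: measurable_bitcode_all => n; apply: measurable_bitcode_and.
  by apply: measurable_bitcode_imp => //; exact: measurable_code_bit.
by apply: measurable_bitcode_imp => //; exact: measurable_code_bit.
Qed.

Let balls_inj x y : balls x = balls y -> x = y.
Proof.
move=> xy; apply: cmetric_eq0; apply/eqP; rewrite eq_le cmetric_ge0 andbT.
apply/ler_addgt0Pr => e e0; rewrite add0r.
have [|n [re tx]] := tr x (e := e / 2); first by rewrite divr_gt0.
have ty : d (t n) y < r n.
  by have := congr1 (fun c : bitcode => c n) xy; rewrite /balls tx => <-.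
by have := cmetric_triangle x (t n) y; rewrite (cmetric_sym x (t n)); lra.
Qed.

Let balls_coherent x : coherent (balls x).
Proof.
split.
- move=> k; have [|n [rn tn]] := tr x (e := k.+1%:R^-1); first by rewrite invr_gt0.
  by exists n.
- move=> n m; rewrite /balls => xn xm.
  by have := cmetric_triangle (t n) x (t m); rewrite (cmetric_sym x); lra.
- move=> n; split=> [xn|[m [xm nm]]]; last first.
    by rewrite /balls in xm *; have := cmetric_triangle (t n) (t m) x; lra.
  rewrite /balls in xn; have [|m [rm tm]] := tr x (e := (r n - d (t n) x) / 2).
    by rewrite divr_gt0// subr_gt0.
  exists m; split=> //.
  by have := cmetric_triangle (t n) x (t m); rewrite (cmetric_sym x); lra.
Qed.

(** Members of [c] with radii below [1 / (k + 1)] have centres closer than the sum of their radii,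
    so these centres form a Cauchy sequence; its limit is the point coded by [c]. *)
Let coherent_balls c : metric_complete d -> coherent c ->
  exists x, balls x = c.
Proof.
move=> cplt [c1 c2 c3].
have [u uP] := choice c1.
have inv_small (e : R) : 0 < e -> exists N : nat, forall n, (N <= n)%N ->
    n.+1%:R^-1 < e.
  move=> e0; exists (Num.truncn e^-1) => n Nn.
  rewrite invf_plt ?posrE//; apply: lt_le_trans (truncnS_gt _) _.
  by rewrite ler_nat.
have [|x xP] := cplt (t \o u).
  move=> e e0; have [|N NP] := inv_small (e / 2); first by rewrite divr_gt0.
  exists N => m n mN nN /=.
  have [cm rm] := uP m; have [cn rn] := uP n.
  have := lt_trans rm (NP _ mN); have := lt_trans rn (NP _ nN).
  by have := c2 _ _ cm cn; lra.
(* The limit loses strictness; the third clause of [coherent] recovers it through a ball of [c]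
   lying deeper inside. *)
have le_r n : c n -> d (t n) x <= r n.
  move=> cn; apply/ler_addgt0Pr => e e0.
  have e20 : 0 < e / 2 by rewrite divr_gt0.
  have [N NP] := xP _ e20; have [N' N'P] := inv_small _ e20.
  pose k := maxn N N'; have [ck rk] := uP k.
  have := NP k (leq_maxl _ _); have := lt_trans rk (N'P k (leq_maxr _ _)).
  have := c2 _ _ cn ck; have := cmetric_triangle (t n) (t (u k)) x.
  by rewrite /=; lra.
exists x; apply/funext => n; apply/idP/idP => [|cn]; rewrite /balls.
  move=> xn; apply: (c3 n).2.
  have [|N NP] := inv_small ((r n - d (t n) x) / 2).
    by rewrite divr_gt0// subr_gt0.
  have [ck rk] := uP N; exists (u N); split=> //.
  have := lt_trans rk (NP _ (leqnn N)); have := le_r _ ck.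
  by have := cmetric_triangle (t n) x (t (u N)); rewrite (cmetric_sym x); lra.
have [m [cm nm]] := (c3 n).1 cn.
by have := le_r _ cm; have := cmetric_triangle (t n) (t m) x; lra.
Qed.

Lemma standard_borel_complete : metric_complete d -> standard_borel (borel X).
Proof.
move=> cplt; pose dec c : borel X := xget point [set x | balls x = c].
have decP c : coherent c -> balls (dec c) = c.
  move=> /(coherent_balls cplt) ex; have [x xP] := ex.
  exact: (xgetPex point ex).
have ballsK x : dec (balls x) = x.
  by apply: balls_inj; exact: decP.
exists coherent, balls, dec; split=> //.
- apply: measurable_fun_codeP => n; rewrite setTI.
  by apply: sub_sigma_algebra; exact: open_metric_ball.
- move=> _; apply: (@measurability _ _ _ (borel X) _ _ (@open X)) => //.
  move=> _ [U oU <-].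
  (* The decoded point lies in [U] iff some ball of [c] is inside [U]. This is a countable union of
     coordinate conditions, inclusion in [U] being independent of [c]. *)
  rewrite (_ : _ `&` _ = coherent `&` [set c : bitcode | exists n, c n /\
      forall y, d (t n) y < r n -> U y]).
    apply: measurableI => //; apply: measurable_bitcode_ex => n.
    apply: measurable_bitcode_and; first exact: measurable_code_bit.
    exact: measurable_bitcode_cst.
  apply/seteqP; split=> c [cc] /=.
    move=> /(ball_basis_open oU) [n [xn nU]]; split=> //; exists n; split=> //.
    by rewrite -(decP _ cc).
  by move=> [n [cn nU]]; split=> //; apply: nU; rewrite -(decP _ cc) in cn.
- by move=> c cc; split=> //; exact: decP.
Qed.

End basis.
End metric.

Lemma standard_borel_polish (R : realType) (X : ptopologicalType) :
  polish R X -> standard_borel (borel X).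
Proof.
move=> [sep [d [dX cplt]]].
have [t [r tr]] := separable_ball_basis dX sep.
exact: standard_borel_complete tr cplt.
Qed.

(** * Open sets and continuous functions for the product sigma-algebra *)

(** By second countability an open set is a countable union of products of basis balls. *)
Lemma open_prod_measurable (R : realType) (X Y : ptopologicalType)
    (U : set (borel X * borel Y)) : polish R X -> polish R Y ->
  open (U : set (X * Y)) -> measurable U.
Proof.
move=> [sepX [dX [cX _]]] [sepY [dY [cY _]]] oU.
have [t [r tr]] := separable_ball_basis cX sepX.
have [t' [r' tr']] := separable_ball_basis cY sepY.
pose V n m : set (borel X * borel Y) :=
  [set x | dX (t n) x < r n] `*` [set y | dY (t' m) y < r' m].
have -> : U = \bigcup_n \bigcup_(m in [set m | V n m `<=` U]) V n m.
  apply/seteqP; split=> [[x y] Uxy|z [n _ [m Vnm]]]; last exact: Vnm.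
  have : nbhs ((x, y) : X * Y) U by exact: open_nbhs_nbhs.
  move=> [[A B] /= [nA nB] ABU].
  move: nA nB; rewrite !nbhsE => -[A' [oA' A'x] A'A] [B' [oB' B'y] B'B].
  have [n [xn nA]] := ball_basis_open cX tr oA' A'x.
  have [m [ym mB]] := ball_basis_open cY tr' oB' B'y.
  exists n => //; exists m => // -[u v] /= [un vm]; apply: ABU; split=> /=.
    by apply: A'A; exact: nA.
  by apply: B'B; exact: mB.
apply: bigcupT_measurable => n; apply: bigcup_measurable => m _.
by apply: measurableX; apply: sub_sigma_algebra; exact: open_metric_ball.
Qed.

Lemma continuous_prod_measurable (R : realType) (X Y : ptopologicalType)
    (f : X * Y -> R) : polish R X -> polish R Y -> continuous f ->
  measurable_fun [set: borel X * borel Y] f.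
Proof.
move=> pX pY cf mT; apply: (measurability _ (RGenOInfty.measurableE R)) => //.
move=> _ [_ [q ->] <-]; rewrite setTI; apply: (open_prod_measurable pX pY).
by move/continuousP : cf; apply; exact: rray_open.
Qed.

(** Integrate the pointwise bound [h <= c + M * \1_W]. *)
Lemma integral_le_off d (T : measurableType d) (R : realType)
    (P : probability T R) (W : set T) (h : T -> R) (c M : R) :
  measurable W -> measurable_fun setT h -> 0 <= c -> 0 <= M ->
  (forall x, 0 <= h x <= M) -> (forall x, ~ W x -> h x <= c) ->
  (\int[P]_x (h x)%:E <= c%:E + M%:E * P W)%E.
Proof.
move=> mW mh c0 M0 hM hc.
have mind : measurable_fun setT (fun x => (\1_W x)%:E : \bar R).
  by apply/measurable_EFinP; exact: measurable_indic.
have mMind : measurable_fun setT (fun x => M%:E * (\1_W x)%:E)%E.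
  exact: measurable_funeM.
have <- : (\int[P]_x (c%:E + M%:E * (\1_W x)%:E) = c%:E + M%:E * P W)%E.
  rewrite ge0_integralD//=; first rewrite ge0_integralZl//.
    rewrite integral_indic// setIT integral_cst//.
    by rewrite [X in (_ * X + _)%E](@probability_setT _ _ _ P) mule1.
  by move=> x _; rewrite mule_ge0// lee_fin.
apply: ge0_le_integral => //.
- by move=> x _; rewrite lee_fin; have /andP[] := hM x.
- exact/measurable_EFinP.
- exact: emeasurable_funD.
- move=> x _; rewrite -EFinM -EFinD lee_fin indicE.
  have [/set_mem Wx|/negP nW] := boolP (x \in W).
    by rewrite mulr1; have /andP[_] := hM x; lra.
  rewrite mulr0 addr0; apply: hc => Wx; apply: nW.
  exact: mem_set.
Qed.

(** * Bijective couplings near a given coupling *)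

Section coupling.
Variables (R : realType) (X Y : ptopologicalType).
Variables (mu : probability (borel X) R) (nu : probability (borel Y) R).
Hypotheses (pX : polish R X) (pY : polish R Y).
Hypotheses (mu0 : nonatomic mu) (nu0 : nonatomic nu).
Variable gamma : probability (borel X * borel Y)%type R.
Hypothesis cplg : cpl mu nu gamma.

Lemma coupling_atomless z : gamma [set z] = 0%E.
Proof.
have sX := standard_borel_polish pX; have sY := standard_borel_polish pY.
apply: (@subset_measure0 _ _ _ gamma _ (fst @^-1` [set z.1])).
- by apply: (@standard_borel_set1 R); exact: standard_borel_prod.
- rewrite -[X in measurable X]setTI; apply: measurable_fst => //.
  exact: (@standard_borel_set1 R).
- by move=> _ ->.
- by apply: (etrans (cplg.1 _ _)); [exact: (@standard_borel_set1 R)|exact: mu0].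
Qed.

(** [S] preserves cells of the first coordinate and [U] those of the second, off null sets. As
    [U (T x) = S x], the point [S x], of law [gamma], is close to [(x, T x)] in both coordinates. *)
Lemma bijective_transport_near (dX : X -> X -> R) (dY : Y -> Y -> R) (e : R) :
  compatible_metric dX -> compatible_metric dY -> 0 < e ->
  exists (T : borel X -> borel Y) (S : borel X -> borel X * borel Y) N,
    [/\ measurable_fun setT T /\ bijective T,
        forall B, measurable B -> mu (T @^-1` B) = nu B,
        measurable_fun setT S /\
        (forall C, measurable C -> mu (S @^-1` C) = gamma C),
        measurable N /\ mu N = 0%E &
        forall x, ~ N x -> dX x (S x).1 < e /\ dY (T x) (S x).2 < e].
Proof.
move=> cX cY e0; have [sepX _] := pX; have [sepY _] := pY.
have [t [r tr]] := separable_ball_basis cX sepX.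
have [t' [r' tr']] := separable_ball_basis cY sepY.
have [a [ma aP]] := small_cells cX tr e0.
have [b [mb bP]] := small_cells cY tr' e0.
have sX := standard_borel_polish pX; have sY := standard_borel_polish pY.
have sZ := standard_borel_prod sX sY.
have [|J|S [S' [iS lS [N1 [mN1 N10 N1P]]]]] :=
    @label_misom _ _ _ _ _ mu gamma a (a \o fst) sX sZ mu0 coupling_atomless ma.
- exact: measurableT_comp ma measurable_fst.
(* The labels have the same law because the first marginal of [gamma] is [mu]. *)
- rewrite comp_preimage -(cplg.1 _ _)//.
  by rewrite -[X in measurable X]setTI; exact: ma.
have [|J|U [U' [iU lU [N2 [mN2 N20 N2P]]]]] :=
    @label_misom _ _ _ _ _ nu gamma b (b \o snd) sY sZ nu0 coupling_atomless mb.
- exact: measurableT_comp mb measurable_snd.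
- rewrite comp_preimage -(cplg.2 _ _)//.
  by rewrite -[X in measurable X]setTI; exact: mb.
have iT := misom_trans iS (misom_sym iU).
have [_ mS _ S'S SS'] := iS; have [_ mU mU' U'U UU'] := iU.
have [_ mT _ TK KT] := iT; pose T := U' \o S.
have lT B : measurable B -> mu (T @^-1` B) = nu B.
  move=> mB; have mUB : measurable (U' @^-1` B).
    by rewrite -[X in measurable X]setTI; exact: mU'.
  rewrite comp_preimage lS// -lU//; congr (nu _).
  by apply/seteqP; split=> y /=; have [_ ->] := U'U y Logic.I.
have mTN : measurable (T @^-1` N2).
  by rewrite -[X in measurable X]setTI; exact: mT.
exists T, S, (N1 `|` T @^-1` N2); split=> //.
- split=> //; exists (S' \o U) => [x|y].
    by have [_] := TK x Logic.I.
  by have [_] := KT y Logic.I.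
- split; first exact: measurableU.
  apply/eqP; rewrite eq_le measure_ge0 andbT.
  apply: (le_trans (measureU2 _ _ _)) => //.
  by rewrite [X in (X + _)%E]N10 [X in (_ + X)%E]lT// N20 adde0.
- move=> x /not_orP[n1 n2]; split; first by apply: aP; exact: N1P.
  apply: bP; rewrite (N2P _ n2) /= /T /=.
  by have [_ ->] := UU' (S x) Logic.I.
Qed.

Lemma graph_coupling (T : borel X -> borel Y) :
  measurable_fun setT T -> bijective T ->
  (forall B, measurable B -> mu (T @^-1` B) = nu B) ->
  exists gamma' : probability (borel X * borel Y)%type R,
    cpl_biM mu nu gamma' /\
    forall C, gamma' C = mu ((fun x => (x, T x)) @^-1` C).
Proof.
move=> mT bT lT.
have mG : measurable_fun setT (fun x => (x, T x)) by exact: measurable_fun_pair.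
have [g' g'E] := pushforward_probability mu mG.
by exists g'; split=> //; exists T; split.
Qed.

(** The law of [((x, T x), S x)] under [mu] couples [alpha] and [beta]. The radius makes each of the
    two distances, raised to the power [p], cost at most a quarter of the [p]-th power of [eps]; the
    total of one half leaves room for a strict inequality. *)
Lemma Wp_lt (p : R) (dX : X -> X -> R) (dY : Y -> Y -> R) (eps : R)
    (alpha beta : probability (borel X * borel Y)%type R)
    (T : borel X -> borel Y) (S : borel X -> borel X * borel Y) N :
  1 <= p -> compatible_metric dX -> compatible_metric dY -> 0 < eps ->
  measurable_fun setT T -> measurable_fun setT S ->
  (forall C, alpha C = mu ((fun x => (x, T x)) @^-1` C)) ->
  (forall C, measurable C -> mu (S @^-1` C) = beta C) ->
  measurable N -> mu N = 0%E ->
  (forall x, ~ N x ->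
    dX x (S x).1 < (eps `^ p / 4) `^ p^-1 /\
    dY (T x) (S x).2 < (eps `^ p / 4) `^ p^-1) ->
  (Wp p dX dY alpha beta < eps%:E)%E.
Proof.
move=> p1 cX cY eps0 mT mS alphaE betaE mN N0 NP.
have p0 : 0 < p by apply: lt_le_trans p1.
have mG : measurable_fun setT (fun x => (x, T x)) by exact: measurable_fun_pair.
have mphi : measurable_fun setT (fun x => ((x, T x), S x)).
  exact: measurable_fun_pair.
have [pi piE] := pushforward_probability mu mphi.
pose cost (z : (borel X * borel Y) * (borel X * borel Y)) : \bar R :=
  (dX z.1.1 z.2.1 `^ p + dY z.1.2 z.2.2 `^ p)%:E.
have mcost : measurable_fun setT cost.
  have [sepX _] := pX; have [sepY _] := pY.
  have [t [r tr]] := separable_ball_basis cX sepX.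
  have [t' [r' tr']] := separable_ball_basis cY sepY.
  apply/measurable_EFinP; apply: measurable_funD.
    apply: (measurableT_comp (measurable_powR p)).
    apply: (measurableT_comp (measurable_dist cX tr)
      (g := fun z : (borel X * borel Y) * (borel X * borel Y) => (z.1.1, z.2.1))).
    by apply: measurable_fun_pair; apply: (measurableT_comp measurable_fst).
  apply: (measurableT_comp (measurable_powR p)).
  apply: (measurableT_comp (measurable_dist cY tr')
    (g := fun z : (borel X * borel Y) * (borel X * borel Y) => (z.1.2, z.2.2))).
  by apply: measurable_fun_pair; apply: (measurableT_comp measurable_snd).
have cost0 z : (0 <= cost z)%E by rewrite lee_fin addr_ge0// powR_ge0.
have eps_p : 0 < eps `^ p by rewrite powR_gt0.
have Wpp_le : (Wpp p dX dY alpha beta <= (eps `^ p / 2)%:E)%E.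
  apply: (@le_trans _ _ (\int[pi]_z cost z)%E).
    apply: ereal_inf_lbound; exists pi => //=; split=> [A mA|B mB].
      by rewrite piE alphaE.
    by rewrite piE -betaE.
  rewrite (@eq_measure_integral _ _ _ _ (pushforward mu (fun x => ((x, T x), S x)))); last first.
    by move=> A mA _; exact: piE.
  rewrite ge0_integral_pushforward// preimage_setT.
  apply: (@le_trans _ _ (\int[mu]_x (cst (eps `^ p / 2)%:E x)))%E; last first.
    by rewrite integral_cst// [X in (_ * X)%E](@probability_setT _ _ _ mu) mule1.
  apply: ae_ge0_le_integral => //.
  - by move=> x _; exact: cost0.
  - exact: measurableT_comp mcost mphi.
  - by move=> x _; rewrite lee_fin divr_ge0// ltW.
  - exists N; split=> // x; apply: contra_notP => nN _.
    have [hX hY] := NP _ nN.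
    rewrite /cost /= lee_fin.
    have root : ((eps `^ p / 4) `^ p^-1) `^ p = eps `^ p / 4.
      by rewrite -powRrM mulVf ?gt_eqF// powRr1// divr_ge0// ltW.
    have h1 : dX x (S x).1 `^ p <= eps `^ p / 4.
      rewrite -root; apply: ge0_ler_powR; rewrite ?nnegrE ?powR_ge0//; try exact: ltW.
      exact: cmetric_ge0 cX _ _.
    have h2 : dY (T x) (S x).2 `^ p <= eps `^ p / 4.
      rewrite -root; apply: ge0_ler_powR; rewrite ?nnegrE ?powR_ge0//; try exact: ltW.
      exact: cmetric_ge0 cY _ _.
    lra.
have Wpp0 : (0 <= Wpp p dX dY alpha beta)%E.
  by apply: le_ereal_inf_tmp => _ [q _ <-]; apply: integral_ge0 => z _; exact: cost0.
rewrite /Wp; case: (Wpp p dX dY alpha beta) Wpp_le Wpp0 => [w| |]//.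
rewrite !lee_fin => wle w0; rewrite poweR_EFin lte_fin.
have -> : eps = (eps `^ p) `^ p^-1 by rewrite -powRrM mulfV ?gt_eqF// powRr1// ltW.
apply: gt0_ltr_powR; rewrite ?invr_gt0 ?nnegrE// ?powR_ge0//.
by apply: le_lt_trans wle _; lra.
Qed.

End coupling.

(** * Weak closeness by control of oscillations *)

Lemma bounded_integrable d (T : measurableType d) (R : realType)
    (P : probability T R) (f : T -> R) (M : R) : measurable_fun setT f ->
  (forall x, `|f x| <= M) -> P.-integrable setT (EFin \o f).
Proof.
move=> mf fM; apply: measurable_bounded_integrable => //.
  by rewrite [ltLHS](@probability_setT _ _ _ P) ltry.
exists M; split; first exact: num_real.
by move=> r Mr x _; exact: le_trans (fM x) (ltW Mr).
Qed.

Lemma integral_transport d1 d2 (X : measurableType d1) (Z : measurableType d2)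
    (R : realType) (P : probability X R) (Q : probability Z R) (phi : X -> Z)
    (f : Z -> R) (M : R) : measurable_fun setT phi ->
  (forall C, measurable C -> P (phi @^-1` C) = Q C) ->
  measurable_fun setT f -> (forall z, `|f z| <= M) ->
  (\int[Q]_z (f z)%:E = \int[P]_x (f (phi x))%:E)%E.
Proof.
move=> mphi PQ mf fM.
rewrite (@eq_measure_integral _ _ _ _ (pushforward P phi)); last first.
  by move=> A mA _; exact/esym/PQ.
rewrite integral_pushforward//; first exact/measurable_EFinP.
rewrite preimage_setT; apply: (@bounded_integrable _ _ _ _ (f \o phi) M).
  exact: measurableT_comp.
by move=> x; exact: fM.
Qed.

Section oscillation.
Variables (R : realType) (X Y : ptopologicalType).
Hypotheses (pX : polish R X) (pY : polish R Y).
Variables (dX : X -> X -> R) (dY : Y -> Y -> R).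
Hypotheses (cX : compatible_metric dX) (cY : compatible_metric dY).
Variables (f : X * Y -> R) (c : R).
Hypotheses (cf : continuous f) (c0 : 0 < c).

(** A substitute for uniform continuity: outside this set, moving by less than [e] in each
    coordinate changes [f] by at most [c]. The strict inequalities make it open, hence measurable
    although [z'] ranges over all points. *)
Definition oscillating (e : R) : set (borel X * borel Y) :=
  [set z | exists z' : X * Y,
    [/\ dX z'.1 z.1 < e, dY z'.2 z.2 < e & c < `|f z' - f z|]].

Lemma measurable_oscillating e : measurable (oscillating e).
Proof.
apply: (open_prod_measurable pX pY).
rewrite (_ : oscillating e = \bigcup_z' (
    fst @^-1` [set x | dX z'.1 x < e] `&` (snd @^-1` [set y | dY z'.2 y < e] `&`
    (fun z => `|f z' - f z|) @^-1` `]c, +oo[)) :> set (X * Y)); last first.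
  apply/seteqP; split=> [z [z' [h1 h2 h3]]|z [z' _ [h1 [h2 h3]]]]; exists z' => //=.
    by do !split=> //; rewrite /= in_itv/= h3.
  by split=> //; move: h3; rewrite /= in_itv/= andbT.
apply: bigcup_open => z' _; apply: openI; [|apply: openI].
- apply: open_comp; last exact: open_metric_ball.
  by move=> z _; exact: cvg_fst.
- apply: open_comp; last exact: open_metric_ball.
  by move=> z _; exact: cvg_snd.
- apply: open_comp; last exact: rray_open.
  move=> z _; apply: (continuous_comp (f := fun z => f z' - f z)).
    by apply: cvgB; [exact: cvg_cst|exact: cf].
  exact: norm_continuous.
Qed.

Lemma oscillating_sub e e' : e <= e' -> oscillating e `<=` oscillating e'.
Proof.
move=> ee' z [z' [h1 h2 h3]]; exists z'; split=> //.
  exact: lt_le_trans ee'.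
exact: lt_le_trans ee'.
Qed.

(** Continuity of [f] at each point makes these sets decrease to the empty set, and [P] is
    continuous from above. *)
Lemma oscillating_small (P : probability (borel X * borel Y)%type R) (eta : R) :
  0 < eta -> exists n : nat, (P (oscillating n.+1%:R^-1) < eta%:E)%E.
Proof.
move=> eta0; apply: contrapT => /forallNP nP.
pose G n := oscillating n.+1%:R^-1.
have mG n : measurable (G n) by exact: measurable_oscillating.
have Gcvg : (P \o G) n @[n --> \oo] --> P (\bigcap_n G n).
  apply: nonincreasing_cvg_mu => //.
  - by apply: (@le_lt_trans _ _ 1%E); [exact: probability_le1|exact: ltry].
  - exact: bigcapT_measurable.
  - move=> i j ij; apply/subsetPset; apply: oscillating_sub.
    by rewrite lef_pV2 ?posrE// ler_nat.
have GE : \bigcap_n G n = set0.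
  apply/seteqP; split=> // -[x y] Gz.
  have /cvgrPdist_lt /(_ c c0) := @cf ((x, y) : X * Y).
  move=> [[A B] /= [nA nB] AB].
  have [e e0 eA] := cmetric_nbhs cX nA; have [e' e'0 e'B] := cmetric_nbhs cY nB.
  pose m := Num.min e e'; have m0 : 0 < m by rewrite lt_min e0.
  have [[x' y'] /= [hx hy hc]] := Gz (Num.truncn m^-1) Logic.I.
  have nm : (Num.truncn m^-1).+1%:R^-1 < m by rewrite invf_plt ?posrE// truncnS_gt.
  have : `|f (x, y) - f (x', y')| < c.
    apply: (AB (x', y')); split=> /=.
      apply: eA; rewrite (cmetric_sym cX) (lt_le_trans (lt_trans hx nm))//.
      by rewrite ge_min lexx.
    apply: e'B; rewrite (cmetric_sym cY) (lt_le_trans (lt_trans hy nm))//.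
    by rewrite ge_min lexx orbT.
  by rewrite distrC ltNge (ltW hc).
have : (eta%:E <= P (\bigcap_n G n))%E.
  rewrite -(cvg_lim _ Gcvg)//; apply: lime_ge.
    by apply/cvg_ex; eexists; exact: Gcvg.
  by apply: nearW => n; rewrite leNgt; apply/negP; exact: nP.
by rewrite GE measure0 lee_fin leNgt eta0.
Qed.

(** Both integrals become means under [mu], of [f (x, T x)] and of [f (S x)]. Taking
    [z' = (x, T x)], the two values differ by at most [c] unless [x] is in [N] or [S x] is in the
    oscillation set, where the bound is [2 * M]. *)
Lemma integral_near (mu : probability (borel X) R)
    (gamma' gamma : probability (borel X * borel Y)%type R) (M e eta : R)
    (T : borel X -> borel Y) (S : borel X -> borel X * borel Y) N :
  (forall z, `|f z| <= M) -> 0 <= M ->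
  measurable_fun setT T -> measurable_fun setT S ->
  (forall C, gamma' C = mu ((fun x => (x, T x)) @^-1` C)) ->
  (forall C, measurable C -> mu (S @^-1` C) = gamma C) ->
  measurable N -> mu N = 0%E ->
  (forall x, ~ N x -> dX x (S x).1 < e /\ dY (T x) (S x).2 < e) ->
  (gamma (oscillating e) < eta%:E)%E ->
  (`|\int[gamma']_z (f z)%:E - \int[gamma]_z (f z)%:E| <=
    (c + (2 * M) * eta)%:E)%E.
Proof.
move=> fM M0 mT mS g'E gE mN N0 NP osc.
have mf : measurable_fun [set: borel X * borel Y] f.
  exact: continuous_prod_measurable.
have mG : measurable_fun setT (fun x => (x, T x)) by exact: measurable_fun_pair.
rewrite (@integral_transport _ _ _ _ _ mu gamma' _ _ M mG _ mf)//.
rewrite (@integral_transport _ _ _ _ _ mu gamma _ _ M mS _ mf)//.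
have mfG : measurable_fun [set: borel X] (fun x => f (x, T x)).
  exact: measurableT_comp mf mG.
have mfS : measurable_fun [set: borel X] (fun x => f (S x)).
  exact: measurableT_comp mf mS.
rewrite -integralB_EFin//; last 2 first.
- exact: (@bounded_integrable _ _ _ _ (fun x => f (x, T x)) M).
- exact: (@bounded_integrable _ _ _ _ (fun x => f (S x)) M).
apply: le_trans (le_abse_integral _ _ _) _ => //.
  by apply: emeasurable_funB; exact/measurable_EFinP.
have mosc : measurable (S @^-1` oscillating e).
  by rewrite -[X in measurable X]setTI; apply: mS => //; exact: measurable_oscillating.
pose W := N `|` S @^-1` oscillating e.
have mW : measurable W by exact: measurableU.
have muW : (mu W <= eta%:E)%E.
  apply: (le_trans (measureU2 _ _ _)) => //.
  rewrite [X in (X + _)%E]N0 add0e [leLHS]gE; first exact: ltW.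
  exact: measurable_oscillating.
apply: (@le_trans _ _ (c%:E + (2 * M)%:E * mu W)%E).
  under eq_integral do rewrite -EFinB abse_EFin.
  apply: integral_le_off => //.
  - by apply: measurableT_comp => //; exact: measurable_funB.
  - exact: ltW.
  - by rewrite mulr_ge0.
  - move=> x; rewrite normr_ge0 /= (le_trans (ler_normB _ _))// mulr2n mulrDl mul1r.
    exact: lerD.
  - move=> x /not_orP[nN nosc]; rewrite leNgt; apply/negP => h; apply: nosc.
    have [h1 h2] := NP _ nN.
    by exists (x, T x).
rewrite EFinD; apply: leeD2l; rewrite (EFinM (2 * M) eta).
by apply: lee_wpmul2l => //; rewrite lee_fin mulr_ge0.
Qed.

End oscillation.

(** Weak density is expressed on basic neighbourhoods of [gamma], given by finitely many bounded
    continuous test functions. Both halves rest on [bijective_transport_near], with different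
    choices of the mesh. *)
Theorem theorem2p6 (R : realType) (X Y : ptopologicalType)
    (mu : probability (borel X) R) (nu : probability (borel Y) R) :
  polish R X -> polish R Y -> nonatomic mu -> nonatomic nu ->
  (* weak density of Cpl_biM in Cpl *)
  (forall gamma : probability (borel X * borel Y)%type R, cpl mu nu gamma ->
     forall (k : nat) (f : 'I_k -> (X * Y)%type -> R),
       (forall i, continuous (f i)) ->
       (forall i, exists M : R, forall z, `|f i z| <= M) ->
       forall eps : R, 0 < eps ->
       exists gamma' : probability (borel X * borel Y)%type R,
         cpl_biM mu nu gamma' /\
         forall i, (`| \int[gamma']_z (f i z)%:E - \int[gamma]_z (f i z)%:E |
                    < eps%:E)%E) /\
  (* W_p density of Cpl_biM in Cpl *)
  (forall (p : R) (dX : X -> X -> R) (dY : Y -> Y -> R),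
     1 <= p -> compatible_metric dX -> compatible_metric dY ->
     finite_moment p dX mu -> finite_moment p dY nu ->
     forall gamma : probability (borel X * borel Y)%type R, cpl mu nu gamma ->
     forall eps : R, 0 < eps ->
     exists gamma' : probability (borel X * borel Y)%type R,
       cpl_biM mu nu gamma' /\ (Wp p dX dY gamma' gamma < eps%:E)%E).
Proof.
move=> pX pY mu0 nu0; split; last first.
  move=> p dX dY p1 cX cY _ _ gamma cplg eps eps0.
  have d0 : 0 < (eps `^ p / 4) `^ p^-1 by rewrite powR_gt0// divr_gt0// powR_gt0.
  have [T [S [N [[mT bT] lT [mS lS] [mN N0] NP]]]] :=
    bijective_transport_near pX pY mu0 nu0 cplg cX cY d0.
  have [gamma' [biM g'E]] := graph_coupling mT bT lT.
  exists gamma'; split=> //.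
  exact: (Wp_lt pX pY p1 cX cY eps0 mT mS g'E lS mN N0 NP).
move=> gamma cplg k f cf bf eps eps0.
(* Weak convergence involves no metric; compatible ones taken from [polish] measure the mesh. *)
have [_ [dX [cX _]]] := pX; have [_ [dY [cY _]]] := pY.
have [M MP] := choice bf.
have c0 : 0 < eps / 4 by rewrite divr_gt0.
have M_ge0 i : 0 <= M i by apply: le_trans (MP i point).
(* With this value as [eta], [2 * M i * eta] is at most [eps / 4], and adding [c = eps / 4] stays
   below [eps]; the [+ 1] keeps the denominator positive when [M i = 0]. *)
have eta0 i : 0 < eps / 4 / (2 * M i + 1).
  by rewrite divr_gt0//; have := M_ge0 i; lra.
have [n nP] := choice (fun i => oscillating_small pX pY cX cY (@cf i) c0 gamma (eta0 i)).
(* Oscillation sets shrink with the radius, so the largest index suits all the test functions at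
   once. *)
pose m := (\max_i n i)%N.
have m0 : 0 < m.+1%:R^-1 :> R by rewrite invr_gt0.
have [T [S [N [[mT bT] lT [mS lS] [mN N0] NP]]]] :=
  bijective_transport_near pX pY mu0 nu0 cplg cX cY m0.
have [gamma' [biM g'E]] := graph_coupling mT bT lT.
exists gamma'; split=> // i.
have osc : (gamma (oscillating dX dY (f i) (eps / 4) m.+1%:R^-1) <
    (eps / 4 / (2 * M i + 1))%:E)%E.
  apply: le_lt_trans (nP i); apply: le_measure.
  - apply: mem_set; exact: (measurable_oscillating pX pY cX cY (eps / 4) (@cf i)).
  - apply: mem_set; exact: (measurable_oscillating pX pY cX cY (eps / 4) (@cf i)).
  - by apply: oscillating_sub; rewrite lef_pV2 ?posrE// ler_nat ltnS leq_bigmax.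
have := integral_near pX pY cX cY (@cf i) c0 (MP i) (M_ge0 i) mT mS g'E lS mN N0 NP osc.
move=> /le_lt_trans; apply; rewrite lte_fin.
have : 2 * M i * (eps / 4 / (2 * M i + 1)) <= eps / 4.
  rewrite mulrA ler_pdivrMr; last by have := M_ge0 i; lra.
  by rewrite mulrC ler_pM2l//; lra.
lra.
Qed.
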